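(* Let $M$ be a CR-submanifold of a locally conformal Kähler manifold $(\overline{M},J,\overline{g})$, with holomorphic distribution $D$, totally real distribution $D^\perp$, and normal bundle decomposition $TM^\perp=JD^\perp\oplus\mu$. Then the following assertions are equivalent: (i) The induced metric $g$ on $M$ is bundle-like for the canonical totally real foliation $\mathfrak{F}^\perp$. (ii) The second fundamental form $h$ of the submanifold and the anti-Lee vector field $A$ satisfy $$g(U,V)A+h(U,JV)+h(V,JU)\in\Gamma(TM)\oplus\Gamma(\mu)$$ for all $U,V\in\Gamma(D)$.
   Context: An almost Hermitian manifold $(\overline{M},J,\overline{g})$ is locally conformal Kähler (l.c.K.) if each point has an open neighbourhood $U$ and a positive function $f_U$ on $U$ such that $\exp(-f_U)\overline{g}_{|U}$ is Kähler. Put $\Omega(X,Y)=\overline{g}(X,JY)$. The Lee form $\omega$ is the globally defined closed 1-form with $\omega_{|U}=df_U$; it satisfies $d\Omega=\omega\wedge\Omega$. The Lee vector field $B$ is defined by $\overline{g}(X,B)=\omega(X)$. The anti-Lee form is $\theta=\omega\circ J$ and the anti-Lee vector field is $A=-JB$. With $\overline{\nabla}$ the Levi-Civita connection of $\overline{g}$, the l.c.K. condition is equivalent to $$(\overline{\nabla}_XJ)Y=\tfrac{1}{2}\left[\theta(Y)X-\omega(Y)JX-\overline{g}(X,Y)A-\Omega(X,Y)B\right].$$ A submanifold $M$ of $\overline{M}$ (with induced metric $g$) is a CR-submanifold if there is a differentiable distribution $D\subset TM$ with $JD_p=D_p$ for all $p\in M$ (holomorphic distribution) whose orthogonal complement $D^\perp$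 in $TM$ satisfies $JD^\perp_p\subset T_p^\perp M$ for all $p$ (totally real distribution). So $TM=D\oplus D^\perp$ and $TM^\perp=JD^\perp\oplus\mu$, where $\mu$ is the orthogonal complement of $JD^\perp$ in the normal bundle $TM^\perp$. $h$ is the second fundamental form of $M$: $\overline{\nabla}_XY=\nabla_XY+h(X,Y)$ for $X,Y$ tangent to $M$, with $\nabla$ the Levi-Civita connection of $(M,g)$. The distribution $D^\perp$ is always integrable (known result of Blair and Chen); the resulting foliation of $M$ is denoted $\mathfrak{F}^\perp$ and called the canonical totally real foliation. Given a foliation $\mathfrak{F}$ on a Riemannian manifold $(M,g)$ with tangent distribution $\mathcal{D}$ and orthogonal (transversal) distribution $\mathcal{D}^\perp$, the metric $g$ is bundle-like for $\mathfrak{F}$ if the induced metric on $\mathcal{D}^\perp$ is parallel with respect to the intrinsic connection on $\mathcal{D}^\perp$; equivalently, $g(\nabla_{Q^\perp Y}QX,Q^\perp Z)+g(\nabla_{Q^\perp Z}QX,Q^\perp Y)=0$ for all $X,Y,Z\in\Gamma(TM)$, where $Q$ and $Q^\perp$ are the projections of $TM$ onto $\mathcal{D}$ and $\mathcal{D}^\perp$. For $\mathfrak{F}^\perp$ the tangent distribution is the totally real distribution $D^\perp$ and the transversal distribution is $D$, so the condition reads $g(\nabla_UX,V)+g(\nabla_VX,U)=0$ for all $X\in\Gamma(D^\perp)$, $U,V\in\Gamma(D)$. *)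

(* Defs.v *)
From HB Require Import structures.
From mathcomp Require Import all_boot all_order all_algebra.
From mathcomp Require Import all_classical all_reals all_analysis.
Set Implicit Arguments.
Unset Strict Implicit.
Unset Printing Implicit Defensive.
Import Order.TTheory GRing.Theory Num.Theory.
Import numFieldNormedType.Exports.
Local Open Scope classical_set_scope.
Local Open Scope ring_scope.

Definition partial (R : realType) (n : nat) (i : 'I_n) (f : 'rV[R]_n -> R)
    (x : 'rV[R]_n) : R :=
  'D_(delta_mx 0 i : 'rV[R]_n) f x.

(* C^oo on the open set U: every iterated partial derivative of f is
   (Frechet) differentiable at every point of U. *)
Definition smooth_on (R : realType) (n : nat) (U : set 'rV[R]_n)
    (f : 'rV[R]_n -> R) : Prop :=
  forall (s : seq 'I_n) (x : 'rV[R]_n), U x ->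
    differentiable (foldr (@partial R n) f s) x.

Record chart (R : realType) (n : nat) (T : topologicalType) := Chart {
  chart_dom : set T;
  chart_coord : T -> 'rV[R]_n;
  chart_param : 'rV[R]_n -> T;
  open_chart_dom : open chart_dom;
  open_chart_img : open (chart_coord @` chart_dom);
  chart_coordK : forall p, chart_dom p -> chart_param (chart_coord p) = p;
  chart_coord_continuous :
    forall p, chart_dom p -> {for p, continuous chart_coord};
  chart_param_continuous :
    forall x, (chart_coord @` chart_dom) x -> {for x, continuous chart_param} }.

Record manifold (R : realType) (n : nat) := Manifold {
  pt :> topologicalType;
  hausdorff_pt : hausdorff_space pt;
  second_countable_pt : @second_countable pt;
  atlas_ix : Type;
  atlas : atlas_ix -> chart R n pt;
  chart_at : pt -> atlas_ix;
  chart_atP : forall p, chart_dom (atlas (chart_at p)) p;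
  smooth_transition : forall a b k,
    smooth_on (chart_coord (atlas a) @`
                 (chart_dom (atlas a) `&` chart_dom (atlas b)))
              (fun x => chart_coord (atlas b) (chart_param (atlas a) x) 0 k) }.

(* The tangent space at p is 'rV[R]_n: a tangent vector is the row of its
   components in the preferred chart [chart_at p]. Tensors at p are likewise
   given by matrices in that chart, linear maps acting on rows from the right,
   and subspaces are row spaces of matrices. *)
Definition vfield (R : realType) (n : nat) (M : manifold R n) :=
  M -> 'rV[R]_n.
Definition covfield (R : realType) (n : nat) (M : manifold R n) :=
  M -> 'rV[R]_n.
Definition bilfield (R : realType) (n : nat) (M : manifold R n) :=
  M -> 'M[R]_n.
Definition endfield (R : realType) (n : nat) (M : manifold R n) :=
  M -> 'M[R]_n.
Definition plane_field (R : realType) (n : nat) (M : manifold R n) :=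
  M -> 'M[R]_n.

Section Calculus.
Context {R : realType} {n : nat} {M : manifold R n}.
Implicit Types (U : set M) (X Y Z : vfield M) (g : bilfield M) (p : M).
Implicit Types (a b : atlas_ix M).

(* partial derivative at p of a function on M with respect to the i-th
   coordinate of the chart a *)
Definition pderiv a (i : 'I_n) (f : M -> R) p : R :=
  partial i (f \o chart_param (atlas a)) (chart_coord (atlas a) p).

Definition smooth_fun U (f : M -> R) : Prop :=
  forall a, smooth_on (chart_coord (atlas a) @` (chart_dom (atlas a) `&` U))
                      (f \o chart_param (atlas a)).

Definition trans a b p : 'M[R]_n :=
  \matrix_(i, j) pderiv a i (fun q => chart_coord (atlas b) q 0 j) p.

Definition vec_in a p (v : 'rV[R]_n) : 'rV[R]_n :=
  v *m trans (chart_at p) a p.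

Definition bil_in a p (G : 'M[R]_n) : 'M[R]_n :=
  trans a (chart_at p) p *m G *m (trans a (chart_at p) p)^T.

Definition end_in a p (L : 'M[R]_n) : 'M[R]_n :=
  trans a (chart_at p) p *m L *m trans (chart_at p) a p.

Definition dirder X (f : M -> R) p : R :=
  \sum_i X p 0 i * pderiv (chart_at p) i f p.

Definition ip g p (v w : 'rV[R]_n) : R := (v *m g p *m w^T) 0 0.

Definition metric_on U g : Prop :=
  [/\ forall p, U p -> (g p)^T = g p,
      forall p, U p -> forall v, v != 0 -> 0 < ip g p v v &
      forall a i j, smooth_fun (U `&` chart_dom (atlas a))
                               (fun q => bil_in a q (g q) i j)].

(* Christoffel symbol Gamma^k_ij at p of the Levi-Civita connection of g, in
   the chart [chart_at p] *)
Definition christoffel g p (k i j : 'I_n) : R :=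
  let dg s t u :=
    pderiv (chart_at p) s (fun q => bil_in (chart_at p) q (g q) t u) p in
  2^-1 * \sum_l invmx (g p) k l * (dg i j l + dg j i l - dg l i j).

Definition nabla g X Y : vfield M := fun p =>
  \row_k (dirder X (fun q => vec_in (chart_at p) q (Y q) 0 k) p
          + \sum_i \sum_j christoffel g p k i j * X p 0 i * Y p 0 j).

Definition bracket X Y : vfield M := fun p =>
  \row_k (dirder X (fun q => vec_in (chart_at p) q (Y q) 0 k) p
          - dirder Y (fun q => vec_in (chart_at p) q (X q) 0 k) p).

Definition apply_end (L : endfield M) X : vfield M := fun p => X p *m L p.

Definition orth g (D : plane_field M) : plane_field M := fun p =>
  kermx (g p *m (D p)^T).

End Calculus.

Section Maps.
Context {R : realType} {n m : nat} {M : manifold R n} {N : manifold R m}.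
Implicit Types (F : M -> N) (X Y : vfield M) (g : bilfield N) (p : M).

Definition smooth_map F : Prop :=
  continuous F /\
  forall b k, smooth_fun (F @^-1` chart_dom (atlas b))
                         (fun q => chart_coord (atlas b) (F q) 0 k).

Definition dmap F p : 'M[R]_(n, m) :=
  \matrix_(i, j) pderiv (chart_at p) i
    (fun q => chart_coord (atlas (chart_at (F p))) (F q) 0 j) p.

Definition immersion F : Prop :=
  smooth_map F /\ forall p, row_free (dmap F p).

(* W p is a vector of the tangent space of N at F p. *)
Definition smooth_along (U : set M) F (W : M -> 'rV[R]_m) : Prop :=
  forall b k, smooth_fun (U `&` F @^-1` chart_dom (atlas b))
                         (fun q => vec_in b (F q) (W q) 0 k).

Definition push F X : M -> 'rV[R]_m := fun p => X p *m dmap F p.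

Definition induced_metric F g : bilfield M := fun p =>
  dmap F p *m g (F p) *m (dmap F p)^T.

(* pull-back along F of the Levi-Civita connection of (N, g) *)
Definition nabla_along F g X (W : M -> 'rV[R]_m) : M -> 'rV[R]_m := fun p =>
  \row_k (dirder X (fun q => vec_in (chart_at (F p)) (F q) (W q) 0 k) p
          + \sum_i \sum_j
              christoffel g (F p) k i j * push F X p 0 i * W p 0 j).

Definition second_fundamental_form F g X Y : M -> 'rV[R]_m := fun p =>
  nabla_along F g X (push F Y) p - push F (nabla (induced_metric F g) X Y) p.

Definition normal_space F g p : 'M[R]_m := kermx (g (F p) *m (dmap F p)^T).

End Maps.

Section Sections.
Context {R : realType} {n : nat} {M : manifold R n}.
Implicit Types (X Y Z : vfield M) (g : bilfield M) (D T : plane_field M).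

Definition vfield_on (U : set M) X : Prop := smooth_along U (@id M) X.

Definition Gamma D X : Prop :=
  vfield_on setT X /\ forall p, (X p <= D p)%MS.

Definition smooth_plane_field (r : nat) D : Prop :=
  forall p, exists U : set M, [/\ open U, U p &
    exists E : 'I_r -> vfield M,
      (forall i, vfield_on U (E i)) /\
      forall q, U q -> let S := \matrix_i E i q in
        row_free S /\ (D q == S)%MS].

(* Intrinsic connection on the orthogonal complement of the tangent
   distribution T of a foliation (Q and Q' being the orthogonal projections onto
   T and onto its complement): Q' nabla_(Q' X) Y + Q' [Q X, Y]. *)
Definition intrinsic_connection g T X Y : vfield M := fun p =>
  let Q : endfield M := fun q => proj_mx (T q) (orth g T q) in
  let Q' : endfield M := fun q => proj_mx (orth g T q) (T q) in
  (nabla g (apply_end Q' X) Y p + bracket (apply_end Q X) Y p) *m Q' p.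

Definition bundle_like g T : Prop :=
  forall X Y Z, vfield_on setT X -> Gamma (orth g T) Y -> Gamma (orth g T) Z ->
  forall p,
    dirder X (fun q => ip g q (Y q) (Z q)) p
    = ip g p (intrinsic_connection g T X Y p) (Z p)
      + ip g p (Y p) (intrinsic_connection g T X Z p).

End Sections.

Section Hermitian.
Context {R : realType} {m : nat} {N : manifold R m}.
Implicit Types (U : set N) (J : endfield N) (g : bilfield N).

Definition almost_hermitian_on U J g : Prop :=
  [/\ metric_on U g,
      forall a i j, smooth_fun (U `&` chart_dom (atlas a))
                               (fun q => end_in a q (J q) i j),
      forall p, U p -> J p *m J p = - 1%:M &
      forall p, U p -> forall v w, ip g p (v *m J p) (w *m J p) = ip g p v w].

Definition kahler_on U J g : Prop :=
  almost_hermitian_on U J g /\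
  forall X Y, vfield_on U X -> vfield_on U Y -> forall p, U p ->
    nabla g X (apply_end J Y) p = apply_end J (nabla g X Y) p.

Definition lck_potential J g U (f : N -> R) : Prop :=
  [/\ open U, forall q, U q -> 0 < f q, smooth_fun U f &
      kahler_on U J (fun q => expR (- f q) *: g q)].

Definition lck J g : Prop :=
  almost_hermitian_on setT J g /\
  forall p, exists U f, U p /\ lck_potential J g U f.

(* In real dimension 2 the local potentials, hence the Lee form, are not
   determined by (J, g): a Lee form is any 1-form which is locally the
   differential of such potentials. *)
Definition lee_form J g (omega : covfield N) : Prop :=
  forall p, exists U f, [/\ U p, lck_potential J g U f &
    forall q, U q -> omega q = \row_i pderiv (chart_at q) i f q].

Definition lee_field g (omega : covfield N) (B : vfield N) : Prop :=
  forall p (v : 'rV[R]_m), ip g p v (B p) = (v *m (omega p)^T) 0 0.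

Definition anti_lee J (B : vfield N) : vfield N := fun p => - (B p *m J p).

End Hermitian.

Section CR.
Context {R : realType} {n m : nat} {M : manifold R n} {N : manifold R m}.
Implicit Types (F : M -> N) (J : endfield N) (g : bilfield N).
Implicit Types (D : plane_field M) (V : vfield M).

Definition CR_submanifold J g F (r : nat) D : Prop :=
  [/\ immersion F, smooth_plane_field r D,
      forall p, (D p *m dmap F p *m J (F p) == D p *m dmap F p)%MS &
      forall p, (orth (induced_metric F g) D p *m dmap F p *m J (F p)
                 <= normal_space F g p)%MS].

(* For V a section of D, J V is tangent to M; this is the vector field on M
   which dmap F sends to J V. *)
Definition tangentJ J F V : vfield M := fun p =>
  push F V p *m J (F p) *m pinvmx (dmap F p).

Definition mu J g F D (p : M) : 'M[R]_m :=
  (normal_space F g p :&: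
   kermx (g (F p) *m
          (orth (induced_metric F g) D p *m dmap F p *m J (F p))^T))%MS.

End CR.

(* Main.v *)
Require Import Defs.
From mathcomp Require Import all_boot all_order all_algebra.
From mathcomp Require Import all_classical all_reals all_analysis.
From mathcomp Require Import ring lra.
Set Implicit Arguments.
Unset Strict Implicit.
Unset Printing Implicit Defensive.
Import Order.TTheory GRing.Theory Num.Theory.
Import numFieldNormedType.Exports.
Local Open Scope classical_set_scope.
Local Open Scope ring_scope.

(** Write Q for the orthogonal projection of TM onto the totally real
    distribution. Since the Levi-Civita connection of g is metric and
    torsion-free, g is bundle-like iff
    [g(nabla_Y (Q X), Z) + g(nabla_Z (Q X), Y) = 0] for Y, Z in the holomorphic
    distribution D, and, as g(Q X, Z) = 0, this says that Q X is orthogonal to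
    [nabla_Y Z + nabla_Z Y]. On the other hand, a vector lies in TM + mu iff it
    is orthogonal to J x for all totally real x. By the Gauss formula and the
    l.c.K. expression of nabla J, in which Omega is antisymmetric, the product
    of [g(U, V) A + h(U, JV) + h(V, JU)] with J x is
    [g(nabla_U V + nabla_V U, x)].
    Every x is the value of some global vector field X, by a bump function.

    All tensors are handled at a single point p, through their components in the
    preferred chart of p, so no transformation law of Christoffel symbols is
    needed. *)

(** * Differential calculus on row vectors *)

(** The formula for nabla J is derived, not assumed: J is parallel for the local metric exp(-f) g,
    and the Koszul formula compares the connection of this metric with that of g. A comparison of
    Koszul formulas also identifies the tangential part of the ambient derivative with the induced
    connection; there the second derivatives of the immersion must commute, so Schwarz's theorem is
    proved for the notion of smoothness in use. Both assertions quantify over the same global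
    sections of D, so U and V are never extended. Global extensions serve only for x and for the
    Kähler condition, which speaks of fields and not of vectors. The field Q X is given by linear
    algebra at each point separately; its differentiability is recovered from a local frame of D and
    its Gram matrix. The coefficient 1 of g(U, V) A comes from nabla J: modulo vectors orthogonal to
    J x, each of h(U, JV) and h(V, JU) contributes one half of g(U, V) JB, and A = -JB. *)

Lemma differentiable_normP (R : realType) (V W : normedModType R)
    (f : V -> W) (x : V) : differentiable f x -> forall e, 0 < e ->
  \forall h \near 0, `|f (h + x) - f x - 'd f x h| <= e * `|h|.
Proof.
move=> /diff_locally /eqaddoP fx e e0.
by have := fx e e0; apply: filterS => h; rewrite /= opprD addrA.
Qed.

(** [g] inherits the first-order expansion of [f] at [x], and [diff_unique] then identifies the two
    differentials. *)
Lemma near_eq_differentiable (R : realType) (V W : normedModType R)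
    (f g : V -> W) (x : V) :
  {near x, f =1 g} -> differentiable f x -> differentiable g x.
Proof.
move=> fg df; have dc := diff_continuous df.
have gx : g \o shift x = cst (g x) + 'd f x +o_ 0 id.
  apply/eqaddoP => e e0; have := differentiable_normP df e0.
  have : \forall h \near 0, f (h + x) = g (h + x).
    have := fg; rewrite (near_shift 0 x) => /=.
    by apply: filterS => h; rewrite /= subr0.
  apply: filterS2 => h /= fgh.
  by rewrite -(nbhs_singleton fg) fgh opprD addrA.
apply/diff_locallyP; have dd := diff_unique dc gx.
by split; rewrite dd.
Qed.

Section PartialCalculus.
Variables (R : realType) (n : nat).
Implicit Types (f g : 'rV[R]_n -> R) (x v : 'rV[R]_n) (U : set 'rV[R]_n).

Lemma near_eq_partial i f g x :
  {near x, f =1 g} -> partial i f x = partial i g x.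
Proof. by move=> fg; rewrite /partial; apply: near_eq_derive. Qed.

Lemma partialD i f g x : differentiable f x -> differentiable g x ->
  partial i (fun y => f y + g y) x = partial i f x + partial i g x.
Proof.
by move=> df dg; rewrite /partial -deriveD//; exact: diff_derivable.
Qed.

Lemma partialM i f g x : differentiable f x -> differentiable g x ->
  partial i (fun y => f y * g y) x = partial i f x * g x + f x * partial i g x.
Proof.
move=> df dg; rewrite /partial [LHS](@deriveM _ _ f g); try exact: diff_derivable.
by rewrite addrC; congr (_ + _); rewrite /GRing.scale/= mulrC.
Qed.

Lemma diff_partial f x v : differentiable f x ->
  'd f x v = \sum_i v 0 i * partial i f x.
Proof.
move=> df; rewrite {1}(row_sum_delta v) linear_sum; apply: eq_bigr => i _.
by rewrite linearZ /partial deriveE.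
Qed.

Lemma differentiable_rV m (G : 'rV[R]_n -> 'rV[R]_m) x :
  (forall j, differentiable (fun y => G y 0 j) x) -> differentiable G x.
Proof.
move=> dG.
have -> : G = \sum_(j < m) (fun y => G y 0 j *: (delta_mx 0 j : 'rV[R]_m)).
  by apply/funext => y; rewrite fct_sumE -row_sum_delta.
by apply: differentiable_sum => j; apply: differentiableZl.
Qed.

Lemma diff_rV m (G : 'rV[R]_n -> 'rV[R]_m) x v j : differentiable G x ->
  'd G x v 0 j = 'd (fun y => G y 0 j) x v.
Proof.
move=> dG; rewrite -!deriveE//; last first.
  exact: (@differentiable_comp _ _ _ _ G (fun N : 'rV[R]_m => N 0 j : R) _ dG
            (differentiable_coord _ _ _)).
by rewrite derive_mx ?mxE//; exact: diff_derivable.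
Qed.

End PartialCalculus.

Lemma partial_comp (R : realType) (n m : nat) i (G : 'rV[R]_n -> 'rV[R]_m)
    (f : 'rV[R]_m -> R) (x : 'rV[R]_n) :
  (forall j, differentiable (fun y => G y 0 j) x) -> differentiable f (G x) ->
  partial i (f \o G) x =
    \sum_j partial i (fun y => G y 0 j) x * partial j f (G x).
Proof.
move=> dGj df; have dG := differentiable_rV dGj.
rewrite /partial deriveE; last exact: differentiable_comp.
rewrite diff_comp//= diff_partial//; apply: eq_bigr => j _; congr (_ * _).
by rewrite diff_rV// deriveE.
Qed.

Lemma differentiable_comp_rV (R : realType) (n m : nat)
    (G : 'rV[R]_n -> 'rV[R]_m) (f : 'rV[R]_m -> R) (x : 'rV[R]_n) :
  (forall j, differentiable (fun y => G y 0 j) x) -> differentiable f (G x) ->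
  differentiable (f \o G) x.
Proof. by move=> dG df; apply: differentiable_comp => //; exact: differentiable_rV. Qed.

(** * Symmetry of second derivatives *)

Section Schwarz.
Variables (R : realType) (V : normedModType R).
Implicit Types (f : V -> R) (x u v : V).

Lemma is_derive_line f x u t : differentiable f (t *: u + x) ->
  is_derive t (1 : R) (fun s : R => f (s *: u + x)) ('D_u f (t *: u + x)).
Proof.
move=> df.
have dl : is_diff t (fun s : R => s *: u + x) (fun s => s *: u).
  have H := is_diffD (is_diff_scalel t u) (is_diff_cst x t).
  by apply: (is_diff_eq H); rewrite addr0.
have dfl := is_diff_comp dl (differentiableP df).
have [dc dE] := dfl; apply: DeriveDef; first exact: diff_derivable.
by rewrite deriveE// dE /= scale1r deriveE.
Qed.

(** The second difference is the increment over [0, h] of t |-> f(tu + hv + x) - f(tu + x). The mean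
    value theorem turns it into h times a difference of two values of ['D_u f], and each value is
    expanded to first order at [x]. Differentiability of ['D_u f] at the single point [x] suffices
    for this. *)
Lemma second_difference f x u v e : 0 < e ->
  (\forall y \near x, differentiable f y) -> differentiable ('D_u f) x ->
  exists2 d, 0 < d & forall h, 0 < h < d ->
    `|f (h *: v + h *: u + x) - f (h *: u + x) - f (h *: v + x) + f x
      - h ^+ 2 * 'D_v ('D_u f) x| <= e * h ^+ 2.
Proof.
(* The two first-order errors are at most e/K times h(|u| + |v|) and h|u|, hence together at most e
   h; the summand 1 keeps [K] positive when u = v = 0. *)
move=> e0 df dg; pose K := 2 * `|u| + `|v| + 1.
have K0 : 0 < K by rewrite ltr_wpDl// addr_ge0// mulr_ge0.
have e'0 : 0 < e / K by rewrite divr_gt0.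
have dfx : \forall y \near 0, differentiable f (y + x).
  have := df; rewrite (near_shift 0 x) /=.
  by apply: filterS => y; rewrite /= subr0.
have : \forall y \near (0 : V), differentiable f (y + x) /\
    `|'D_u f (y + x) - 'D_u f x - 'd ('D_u f) x y| <= e / K * `|y|.
  by apply: filterI => //; exact: differentiable_normP dg _ e'0.
move=> /nbhs_ballP[d /= d0 Hd].
exists (d / K); first by rewrite divr_gt0.
move=> h /andP[h0 hd].
have small (s t : R) : 0 <= s <= h -> 0 <= t <= h -> ball 0 d (s *: u + t *: v).
  move=> /andP[s0 sh] /andP[t0 th]; rewrite -ball_normE /= sub0r normrN.
  rewrite (le_lt_trans (ler_normD _ _))// !normrZ !ger0_norm//.
  apply: (@le_lt_trans _ _ (h * (`|u| + `|v|))).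
    by rewrite mulrDr lerD// ler_wpM2r.
  apply: (@le_lt_trans _ _ (h * K)); last by rewrite -ltr_pdivlMr.
  rewrite ler_wpM2l ?(ltW h0)// /K; have := normr_ge0 u; lra.
pose phi (t : R) := f (t *: u + (h *: v + x)) - f (t *: u + x).
pose dphi (t : R) := 'D_u f (t *: u + (h *: v + x)) - 'D_u f (t *: u + x).
have hh : 0 <= h <= h by rewrite lexx ltW.
have z0 : 0 <= (0 : R) <= h by rewrite lexx ltW.
have dphiE t : 0 <= t <= h -> is_derive t (1 : R) phi (dphi t).
  move=> th; rewrite /phi /dphi; apply: is_deriveB; apply: is_derive_line.
    by rewrite addrA; apply: (Hd _ (small _ _ th hh)).1.
  by have := (Hd _ (small _ _ th z0)).1; rewrite scale0r addr0.
have [||c] := @MVT R phi dphi 0 h h0.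
- by move=> t; rewrite in_itv /= => /andP[t0 th]; apply: dphiE; rewrite !ltW.
- apply: derivable_within_continuous => t; rewrite in_itv /= => th.
  by have [] := dphiE _ th.
rewrite in_itv /= => /andP[c0 ch]; rewrite subr0 => Hc.
have cc : 0 <= c <= h by rewrite !ltW.
have H1 := (Hd _ (small _ _ cc hh)).2; have H2 := (Hd _ (small _ _ cc z0)).2.
rewrite scale0r addr0 in H2.
have -> : f (h *: v + h *: u + x) - f (h *: u + x) - f (h *: v + x) + f x
  = phi h - phi 0.
  rewrite /phi !scale0r !add0r addrA (addrC (h *: u)); ring.
rewrite Hc expr2 (deriveE _ dg).
have -> : dphi c * h - h * h * 'd ('D_u f) x v =
  (('D_u f (c *: u + h *: v + x) - 'D_u f x - 'd ('D_u f) x (c *: u + h *: v))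
   - ('D_u f (c *: u + x) - 'D_u f x - 'd ('D_u f) x (c *: u))) * h.
  rewrite /dphi addrA [X in _ = (_ - X - _) * _]linearD linearZ /=.
  rewrite [X in _ = (_ - (_ + X) - _) * _]linearZ /= /GRing.scale /=; ring.
rewrite normrM (ger0_norm (ltW h0)) mulrA ler_wpM2r ?(ltW h0)//.
apply: (le_trans (ler_normB _ _)); apply: (le_trans (lerD H1 H2)).
rewrite -mulrDr -mulrA ler_wpM2l ?(ltW e0)// ler_pdivrMl// (mulrC K).
have N1 : `|c *: u + h *: v| <= h * (`|u| + `|v|).
  rewrite (le_trans (ler_normD _ _))// !normrZ !ger0_norm ?(ltW c0) ?(ltW h0)//.
  by rewrite mulrDr lerD2r ler_wpM2r// ltW.
have N2 : `|c *: u| <= h * `|u|.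
  by rewrite normrZ ger0_norm ?(ltW c0)// ler_wpM2r// ltW.
apply: (le_trans (lerD N1 N2)); rewrite -mulrDr ler_wpM2l ?(ltW h0)// /K; lra.
Qed.

(* Both iterated derivatives are limits of the same symmetric second difference
   quotient. *)
Lemma deriveC f x u v : (\forall y \near x, differentiable f y) ->
  differentiable ('D_u f) x -> differentiable ('D_v f) x ->
  'D_v ('D_u f) x = 'D_u ('D_v f) x.
Proof.
move=> df du dv; apply/eqP; rewrite -subr_eq0 -normr_le0.
apply/ler_addgt0Pr => e e0; rewrite add0r; have e2 : 0 < e / 2 by rewrite divr_gt0.
have [d1 d10 H1] := second_difference v e2 df du.
have [d2 d20 H2] := second_difference u e2 df dv.
pose h := Num.min d1 d2 / 2.
have m0 : 0 < Num.min d1 d2 by rewrite lt_min d10.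
have h0 : 0 < h by rewrite divr_gt0.
have hm : h < Num.min d1 d2 by rewrite /h ltr_pdivrMr// ltr_pMr// ltr1n.
have /andP[h1 h2] : (h < d1) && (h < d2) by rewrite -lt_min.
have {}H1 := H1 h; have {}H2 := H2 h; rewrite h0 h1 in H1; rewrite h0 h2 in H2.
have {}H1 := H1 isT; have {}H2 := H2 isT.
rewrite (addrC (h *: u)) in H2.
have h20 : 0 < h ^+ 2 by rewrite exprn_gt0.
move: H1 H2 h20.
move: ('D_v ('D_u f) x) ('D_u ('D_v f) x) (f (h *: v + h *: u + x)).
move: (f (h *: v + x)) (f (h *: u + x)) (f x) (h ^+ 2) => a b c k A B q.
rewrite !ler_norml => /andP[? ?] /andP[? ?] k0.
by apply/andP; split; rewrite -(ler_pM2l k0); lra.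
Qed.

End Schwarz.

(** * Closure properties of smooth functions of row vectors *)

Section Smooth.
Variables (R : realType) (n : nat).
Implicit Types (f g : 'rV[R]_n -> R) (U : set 'rV[R]_n).

(** Smoothness up to order [k], with the innermost derivative split off first: the product and chain
    rules apply to that derivative, so closure properties follow by induction on [k]. *)
Fixpoint diffk (k : nat) U f : Prop :=
  (forall x, U x -> differentiable f x) /\
  if k is k'.+1 then forall i, diffk k' U (partial i f) else True.

Lemma smooth_diffk U f : smooth_on U f <-> forall k, diffk k U f.
Proof.
split=> [Uf k|Uf s].
  elim: k f Uf => [|k IH] f Uf; first by split=> // x; exact: (Uf [::]).
  split=> [x|i]; first exact: (Uf [::]).
  apply: IH => s x Ux; have := Uf (rcons s i) x Ux.
  by rewrite foldr_rcons.
elim/last_ind: s f Uf => [|s i IH] f Uf x Ux.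
  by have [+ _] := Uf 0%N; apply.
rewrite foldr_rcons; apply: IH => // k.
by have [_ +] := Uf k.+1; apply.
Qed.

Lemma smooth_on_differentiable U f x : smooth_on U f -> U x ->
  differentiable f x.
Proof. by move=> /(_ [::]); apply. Qed.

Lemma smooth_on_partial U f i : smooth_on U f -> smooth_on U (partial i f).
Proof. by move=> Uf s x /(Uf (rcons s i)); rewrite foldr_rcons. Qed.

Lemma smooth_on_sub U U' f : U' `<=` U -> smooth_on U f -> smooth_on U' f.
Proof. by move=> UU Uf s x /UU; exact: Uf. Qed.

Lemma partialC U f x i j : open U -> smooth_on U f -> U x ->
  partial i (partial j f) x = partial j (partial i f) x.
Proof.
move=> oU Uf Ux; apply: deriveC.
- have := open_nbhs_nbhs (conj oU Ux); apply: filterS => y.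
  exact: smooth_on_differentiable Uf.
- exact: smooth_on_differentiable (smooth_on_partial j Uf) Ux.
- exact: smooth_on_differentiable (smooth_on_partial i Uf) Ux.
Qed.

Lemma diffk_differentiable k U f x : diffk k U f -> U x -> differentiable f x.
Proof. by case: k => [|k] [+ _]; apply. Qed.

Lemma diffkW k U f : diffk k.+1 U f -> diffk k U f.
Proof.
elim: k f => [|k IH] f; first by case.
by move=> [df pf]; split=> // i; apply: IH.
Qed.

Lemma diffk_eq k U f g : open U -> {in U, f =1 g} -> diffk k U f -> diffk k U g.
Proof.
move=> oU; have E f' g' x : {in U, f' =1 g'} -> U x -> {near x, f' =1 g'}.
  move=> fg Ux; apply: filterS (open_nbhs_nbhs (conj oU Ux)) => y Uy.
  by apply: fg; rewrite inE.
elim: k f g => [|k IH] f g fg [df pf]; (split; [move=> x Ux|]) => //.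
- exact: near_eq_differentiable (E _ _ _ fg Ux) (df x Ux).
- exact: near_eq_differentiable (E _ _ _ fg Ux) (df x Ux).
- move=> i; apply: IH (pf i) => x /set_mem Ux.
  exact: near_eq_partial (E _ _ _ fg Ux).
Qed.

Lemma diffk_cst k U (c : R) : diffk k U (fun=> c).
Proof.
elim: k c => [|k IH] c; (split; [move=> x _; exact: differentiable_cst|]) => // i.
have -> : partial i (fun=> c) = fun=> 0.
  by apply/funext => x; rewrite /partial derive_cst.
exact: IH.
Qed.

Lemma diffk_coord k U j : diffk k U (fun x => x 0 j).
Proof.
case: k => [|k]; (split; [move=> x _; exact: differentiable_coord|]) => // i.
have -> : partial i (fun x => x 0 j) = fun=> (i == j)%:R :> R.
  apply/funext => x; rewrite /partial.
  rewrite deriveE; last exact: differentiable_coord.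
  rewrite -[LHS](@diff_rV _ _ _ id x _ j)//.
  by rewrite diff_val mxE eqxx/= eq_sym.
exact: diffk_cst.
Qed.

Lemma diffkD k U f g : open U -> diffk k U f -> diffk k U g ->
  diffk k U (fun x => f x + g x).
Proof.
move=> oU; elim: k f g => [|k IH] f g [df pf] [dg pg];
  (split; [by move=> x Ux; apply: differentiableD; auto|]) => // i.
apply: (diffk_eq oU) (IH _ _ (pf i) (pg i)) => x /set_mem Ux.
by rewrite partialD; auto.
Qed.

Lemma diffkM k U f g : open U -> diffk k U f -> diffk k U g ->
  diffk k U (fun x => f x * g x).
Proof.
move=> oU; elim: k f g => [|k IH] f g hf hg.
  by move: hf hg => [df _] [dg _]; split=> // x Ux; apply: differentiableM; auto.
have hf' := diffkW hf; have hg' := diffkW hg.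
move: hf hg => [df pf] [dg pg]; split=> [x Ux|i].
  by apply: differentiableM; auto.
apply: (diffk_eq oU _ (diffkD oU (IH _ _ (pf i) hg') (IH _ _ hf' (pg i)))).
by move=> x /set_mem Ux; rewrite partialM; auto.
Qed.

Lemma diffk_sum k U (I : Type) (s : seq I) (f : I -> 'rV[R]_n -> R) :
  open U -> (forall i, diffk k U (f i)) ->
  diffk k U (fun x => \sum_(i <- s) f i x).
Proof.
move=> oU hf; elim: s => [|a s IH].
  by apply: (diffk_eq oU) (diffk_cst k U 0) => x _; rewrite big_nil.
apply: (diffk_eq oU) (diffkD oU (hf a) IH) => x _.
by rewrite big_cons.
Qed.

End Smooth.

(** By the chain rule a partial derivative of [f \o G] is a sum of products of partial derivatives
    of [G] with composites [partial j f \o G], all of one order less. *)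
Lemma diffk_comp (R : realType) (n m k : nat) (U : set 'rV[R]_n)
    (V : set 'rV[R]_m) (G : 'rV[R]_n -> 'rV[R]_m) (f : 'rV[R]_m -> R) :
  open U -> (forall x, U x -> V (G x)) ->
  (forall j, diffk k U (fun x => G x 0 j)) -> diffk k V f ->
  diffk k U (f \o G).
Proof.
move=> oU UV; elim: k f => [|k IH] f hG hf.
  split=> // x Ux; apply: differentiable_comp_rV.
    by move=> j; case: (hG j) => + _; apply.
  by case: hf => + _; apply; exact: UV.
split=> [x Ux|i].
  apply: differentiable_comp_rV.
    by move=> j; case: (hG j) => + _; apply.
  by case: hf => + _; apply; exact: UV.
have h : diffk k U (fun x => \sum_j partial i (fun y => G y 0 j) x
                                      * (partial j f \o G) x).
  apply: diffk_sum => // j; apply: diffkM => //.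
    by case: (hG j) => _; apply.
  apply: (IH (partial j f)) => [l|]; first exact: diffkW (hG l).
  by case: hf => _; apply.
apply: (diffk_eq oU _ h) => x /set_mem Ux; rewrite partial_comp//.
  by move=> j; case: (hG j) => + _; apply.
by case: hf => + _; apply; exact: UV.
Qed.

Lemma smooth_on_comp (R : realType) (n m : nat) (U : set 'rV[R]_n)
    (V : set 'rV[R]_m) (G : 'rV[R]_n -> 'rV[R]_m) (f : 'rV[R]_m -> R) :
  open U -> (forall x, U x -> V (G x)) ->
  (forall j, smooth_on U (fun x => G x 0 j)) -> smooth_on V f ->
  smooth_on U (f \o G).
Proof.
move=> oU UV hG /smooth_diffk hf; apply/smooth_diffk => k.
by apply: (diffk_comp oU UV _ (hf k)) => j; have /smooth_diffk := hG j; apply.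
Qed.

Lemma smooth_on_eq (R : realType) (n : nat) (U : set 'rV[R]_n) f g :
  open U -> {in U, f =1 g} -> smooth_on U f -> smooth_on U g.
Proof.
move=> oU fg /smooth_diffk hf; apply/smooth_diffk => k.
exact: diffk_eq (hf k).
Qed.

Lemma smooth_onM (R : realType) (n : nat) (U : set 'rV[R]_n) f g :
  open U -> smooth_on U f -> smooth_on U g -> smooth_on U (fun x => f x * g x).
Proof.
move=> oU /smooth_diffk hf /smooth_diffk hg; apply/smooth_diffk => k.
exact: diffkM.
Qed.

(** * The flat function exp(-1/t) *)

Section Flat.
Variable R : realType.

(* t^-k exp(-1/t), extended by 0: this family is closed under d/dt. *)
Definition flat (k : nat) (t : R) : R :=
  if 0 < t then t^-1 ^+ k * expR (- t^-1) else 0.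

Lemma flat_bound k t : `|flat k t| <= (k.+1)`!%:R * `|t|.
Proof.
rewrite /flat; case: ifPn => [t0|_]; last by rewrite normr0 mulr_ge0.
have ti : 0 < t^-1 by rewrite invr_gt0.
rewrite ger0_norm ?mulr_ge0 ?expR_ge0 ?exprn_ge0 ?(ltW ti)//.
rewrite (gtr0_norm t0) expRN ler_pdivrMr ?expR_gt0//.
have f0 : 0 < (k.+1)`!%:R :> R by rewrite ltr0n fact_gt0.
have tf : 0 < (k.+1)`!%:R * t by rewrite mulr_gt0.
rewrite -ler_pdivrMl//; apply: le_trans (expR_ge1Dxn k (ltW ti)).
by rewrite exprS invfM (mulrC _ t^-1) -!mulrA (mulrC _ (t^-1 ^+ k)) lerDr.
Qed.

Lemma is_derive_flat k (t : R) :
  is_derive t (1 : R) (flat k) (flat k.+2 t - k%:R * flat k.+1 t).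
Proof.
have [t0|t0|->] := ltgtP t 0.
- have -> : flat k.+2 t - k%:R * flat k.+1 t = 0.
    by rewrite /flat ltNge (ltW t0)/= mulr0 subr0.
  apply: (@near_eq_is_derive R R R (cst 0)).
  have : \forall s \near t, s < 0 by exact: lt_nbhsl.
  by apply: filterS => s s0; rewrite /flat ltNge (ltW s0).
- pose F := ((fun s : R => s^-1) ^+ k) * (fun s : R => expR (- s^-1)).
  apply: (@near_eq_is_derive R R R F).
    have : \forall s \near t, 0 < s by exact: lt_nbhsr.
    apply: filterS => s s0; rewrite /flat s0 /F.
    by rewrite -[LHS]/((_ ^+ k) s * _) fctE.
  have tn : t != 0 by rewrite gt_eqF.
  have di : is_derive t 1 (fun s : R => s^-1) (- t ^- 2).
    apply: DeriveDef; first exact: (@derivableV _ _ id t 1 tn).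
    by rewrite (@deriveV _ _ id t 1 tn)// derive_id /GRing.scale /= mulr1.
  have de : is_derive t 1 (fun s : R => expR (- s^-1)) (t ^- 2 * expR (- t^-1)).
    have := is_deriveN di; rewrite opprK => dn.
    have H := @is_derive1_comp R expR (fun s => - s^-1) t _ _ _ dn.
    by apply: is_derive_eq; rewrite mulrC.
  have dp := is_deriveX k di.
  have dm := is_deriveM dp de; apply: (is_derive_eq dm).
  rewrite /flat t0 /GRing.scale /= !fctE.
  clear dm; case: k {F dp} => [|k] /=.
    by rewrite !expr0 !mulr0n !mul0r !mulr0 addr0 subr0 mul1r exprVn.
  rewrite -[t ^- 2]exprVn.
  rewrite !(exprS _ k.+2) !(exprS _ k.+1) !(exprS _ k); move: (t^-1) (expR _) => a E.
  move: (a ^+ k) (k.+1%:R) => P c. ring.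
- have -> : flat k.+2 0 - k%:R * flat k.+1 0 = 0 by rewrite /flat ltxx mulr0 subr0.
  suff H : h^-1 *: (flat k (h *: 1 + 0) - flat k 0) @[h --> 0^'] --> (0 : R).
    apply: DeriveDef; first by apply/cvg_ex; exists 0; exact: H.
    exact: cvg_lim H.
  apply/cvgr0Pnorm_le => e e0.
  have f0 : 0 < (k.+2)`!%:R :> R by rewrite ltr0n fact_gt0.
  have ef : 0 < e / (k.+2)`!%:R by rewrite divr_gt0.
  near=> h.
  have hn : h != 0 by near: h; exact: nbhs_dnbhs_neq.
  have hs : `|h| < e / (k.+2)`!%:R by near: h; exact: dnbhs0_lt.
  rewrite addr0 [X in flat k X]mulr1 {2}/flat ltxx subr0.
  (* The difference quotient at 0 is again a member of the family, so [flat_bound] sends it to 0. *)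
  have -> : h^-1 *: flat k h = flat k.+1 h.
    by rewrite /flat /GRing.scale /=; case: ifP; rewrite ?mulr0// exprS mulrA.
  by apply: (le_trans (flat_bound _ _)); rewrite -ler_pdivlMl// mulrC ltW.
Unshelve. all: by end_near. Qed.

Lemma partial_comp1 n (phi : R -> R) d (f : 'rV[R]_n -> R) x i :
  differentiable f x -> is_derive (f x) (1 : R) phi d ->
  partial i (phi \o f) x = d * partial i f x.
Proof.
move=> df [dphi phiE]; have {}dphi := (derivable1_diffP _ _).1 dphi.
rewrite /partial [LHS]deriveE; last exact: differentiable_comp.
rewrite diff_comp//= [in RHS]deriveE// -[X in 'd phi _ X]mulr1.
by rewrite [LHS]linearZ /= -(deriveE (1 : R) dphi) phiE mulrC.
Qed.

(** The index [k] varies in the induction on [N], since a derivative replaces [flat k] by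
    [flat k.+2] and [flat k.+1]. *)
Lemma diffk_flat n N k (U : set 'rV[R]_n) (rho : 'rV[R]_n -> R) :
  open U -> (forall N, diffk N U rho) -> diffk N U (flat k \o rho).
Proof.
move=> oU hr.
have dfl l t : differentiable (flat l) t.
  by apply/derivable1_diffP; have [] := is_derive_flat l t.
have dcomp l x : U x -> differentiable (flat l \o rho) x.
  move=> Ux; apply: differentiable_comp => //.
  exact: diffk_differentiable (hr 0%N) Ux.
elim: N k => [|N IH] k; (split; [exact: dcomp|]) => // i.
have h : diffk N U (fun x => ((flat k.+2 \o rho) x +
            (- k%:R) * (flat k.+1 \o rho) x) * partial i rho x).
  apply: diffkM => //; last by case: (hr N.+1) => _; apply.
  by apply: diffkD => //; apply: diffkM => //; exact: diffk_cst.
apply: (diffk_eq oU _ h) => x /set_mem Ux.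
have dr := diffk_differentiable (hr 0%N) Ux.
by rewrite (partial_comp1 _ dr (is_derive_flat k (rho x))) /= mulNr.
Qed.

End Flat.

(** * Charts and point derivations *)

Local Notation dom a := (chart_dom (atlas a)).
Local Notation coord a := (chart_coord (atlas a)).
Local Notation param a := (chart_param (atlas a)).

Section Charts.
Variables (R : realType) (n : nat) (M : manifold R n).
Implicit Types (a b : atlas_ix M) (p q : M) (f g : M -> R).

Lemma near_dom a p : dom a p -> \forall q \near p, dom a q.
Proof. by move=> ap; exact: open_nbhs_nbhs (conj (open_chart_dom _) ap). Qed.

Lemma near_param a p (P : set M) : dom a p -> (\forall q \near p, P q) ->
  \forall x \near coord a p, P (param a x).
Proof.
move=> ap Pp.
have := @chart_param_continuous _ _ _ (atlas a) (coord a p).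
move=> /(_ (ex_intro2 _ _ p ap erefl)); rewrite /prop_for /continuous_at chart_coordK//.
by apply.
Qed.

Lemma near_img a p : dom a p -> \forall x \near coord a p, (coord a @` dom a) x.
Proof.
move=> ap; apply: open_nbhs_nbhs; split; first exact: open_chart_img.
by exists p.
Qed.

Lemma chart_paramK a x : (coord a @` dom a) x -> coord a (param a x) = x.
Proof. by case=> q aq <-; rewrite chart_coordK. Qed.

Lemma open_chart_image a (U : set M) : open U -> open (coord a @` (dom a `&` U)).
Proof.
move=> oU; rewrite openE => _ [p [ap Up] <-]; rewrite /interior.
have h := near_param ap (open_nbhs_nbhs (conj oU Up)).
apply: filterS2 h (near_img ap) => x Ux [q aq qx]; exists q => //; split=> //.
by rewrite -(chart_coordK aq) qx.
Qed.

Definition pdiff a p f := differentiable (f \o param a) (coord a p).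

Lemma near_comp_param a p f g : dom a p -> {near p, f =1 g} ->
  {near coord a p, f \o param a =1 g \o param a}.
Proof. by move=> ap fg; exact: near_param fg. Qed.

Lemma near_eq_pdiff a p f g : dom a p -> {near p, f =1 g} ->
  pdiff a p f -> pdiff a p g.
Proof. by move=> ap fg; apply: near_eq_differentiable; exact: near_comp_param. Qed.

Lemma near_eq_pderiv a i p f g : dom a p -> {near p, f =1 g} ->
  pderiv a i f p = pderiv a i g p.
Proof. by move=> ap fg; apply: near_eq_partial; exact: near_comp_param. Qed.

Lemma smooth_fun_pdiff a (U : set M) f p : smooth_fun U f -> U p -> dom a p ->
  pdiff a p f.
Proof.
by move=> Uf Up ap; apply: smooth_on_differentiable (Uf a) _; exists p.
Qed.

Lemma smooth_fun_sub (U U' : set M) f : U' `<=` U -> smooth_fun U f ->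
  smooth_fun U' f.
Proof.
move=> UU Uf a; apply: smooth_on_sub (Uf a) => _ [p [ap Up] <-].
by exists p => //; split=> //; exact: UU.
Qed.

Lemma smooth_map_id : smooth_map (@id M).
Proof.
split; first by move=> p; exact: cvg_id.
by move=> b k a; exact: smooth_transition.
Qed.

End Charts.

(** * Jacobians in charts and the chain rule *)

Section Jacobian.
Variables (R : realType) (n m : nat) (M : manifold R n) (N : manifold R m).
Implicit Types (F : M -> N) (a : atlas_ix M) (b : atlas_ix N).

(** For the identity map this is [trans], and in preferred charts it is [dmap], both by conversion.
    The single chain rule [jac_comp] thus gives the cocycle rule for [trans] and the effect of a
    change of chart on either side. *)
Definition jac F a b (q : M) : 'M[R]_(n, m) :=
  \matrix_(i, j) pderiv a i (fun q => coord b (F q) 0 j) q.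

Lemma smooth_map_near F b p : smooth_map F -> dom b (F p) ->
  \forall q \near p, dom b (F q).
Proof. by move=> [Fc _] bFp; apply: (Fc p); exact: near_dom. Qed.

Lemma smooth_map_pdiff F a b p j : smooth_map F -> dom a p -> dom b (F p) ->
  pdiff a p (fun q => coord b (F q) 0 j).
Proof. by move=> [_ Fs] ap bFp; apply: smooth_fun_pdiff (Fs b j) _ ap. Qed.

Section Composite.
Variables (F : M -> N) (a : atlas_ix M) (b : atlas_ix N) (p : M) (f : N -> R).
Hypotheses (sF : smooth_map F) (ap : dom a p) (bFp : dom b (F p)).
Hypothesis (df : pdiff b (F p) f).

Let G (x : 'rV[R]_n) : 'rV[R]_m := coord b (F (param a x)).

Let fG : {near coord a p, (f \o param b) \o G =1 (f \o F) \o param a}.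
Proof.
have := near_param ap (smooth_map_near sF bFp).
by apply: filterS => x bx; rewrite /G /= chart_coordK.
Qed.

Let dG j : differentiable (fun x => G x 0 j) (coord a p).
Proof. exact: smooth_map_pdiff j sF ap bFp. Qed.

Let dfG : differentiable (f \o param b) (G (coord a p)).
Proof. by rewrite /G chart_coordK. Qed.

Lemma pdiff_comp : pdiff a p (f \o F).
Proof. exact: near_eq_differentiable fG (differentiable_comp_rV dG dfG). Qed.

Lemma pderiv_comp i :
  pderiv a i (f \o F) p = \sum_j jac F a b p i j * pderiv b j f (F p).
Proof.
rewrite /pderiv -(near_eq_partial i fG) partial_comp//.
by apply: eq_bigr => j _; rewrite mxE /G chart_coordK.
Qed.

End Composite.

End Jacobian.

Lemma jac_comp (R : realType) (n m l : nat) (M : manifold R n)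
    (N : manifold R m) (P : manifold R l) (F : M -> N) (G : N -> P) a b c p :
  smooth_map F -> smooth_map G -> dom a p -> dom b (F p) -> dom c (G (F p)) ->
  jac (G \o F) a c p = jac F a b p *m jac G b c (F p).
Proof.
move=> sF sG ap bFp cp; apply/matrixP => i j; rewrite !mxE.
have dg := smooth_map_pdiff j sG bFp cp.
rewrite [LHS](pderiv_comp sF ap bFp dg).
by apply: eq_bigr => k _; rewrite [jac G b c _ _ _]mxE.
Qed.

Section Transition.
Variables (R : realType) (n m : nat) (M : manifold R n) (N : manifold R m).
Variable F : M -> N.
Hypothesis sF : smooth_map F.

Lemma trans_comp (a b c : atlas_ix M) p : dom a p -> dom b p -> dom c p ->
  trans a b p *m trans b c p = trans a c p.
Proof.
move=> ap bp cp; apply/esym.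
exact: (jac_comp (smooth_map_id M) (smooth_map_id M) ap bp cp).
Qed.

Lemma trans_id (a : atlas_ix M) p : dom a p -> trans a a p = 1%:M.
Proof.
move=> ap; apply/matrixP => i j; rewrite !mxE /pderiv.
rewrite (@near_eq_partial _ _ _ _ (fun x => x 0 j)).
  rewrite /partial deriveE; last exact: differentiable_coord.
  rewrite -[LHS](@diff_rV _ _ _ id _ _ j)//.
  by rewrite diff_val mxE eqxx/= eq_sym.
by apply: filterS (near_img ap) => x ix /=; rewrite chart_paramK.
Qed.

Lemma trans_jac a a' b p : dom a p -> dom a' p -> dom b (F p) ->
  trans a a' p *m jac F a' b p = jac F a b p.
Proof.
move=> ap a'p bp; apply/esym.
exact: (jac_comp (smooth_map_id M) sF ap a'p bp).
Qed.

Lemma jac_trans a b b' p : dom a p -> dom b (F p) -> dom b' (F p) ->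
  jac F a b p *m trans b b' (F p) = jac F a b' p.
Proof.
move=> ap bp b'p; apply/esym.
exact: (jac_comp sF (smooth_map_id N) ap bp b'p).
Qed.

Lemma transV (a b : atlas_ix M) p : dom a p -> dom b p ->
  trans a b p *m trans b a p = 1%:M.
Proof. by move=> ap bp; rewrite trans_comp// trans_id. Qed.

End Transition.

(** * Tangent vectors as derivations of functions and of matrix fields *)

Section PointDerivation.
Variables (R : realType) (n : nat) (M : manifold R n).
Implicit Types (p q : M) (v w : 'rV[R]_n) (f g : M -> R).

(* The tangent vector v at p acting on f. *)
Definition dd p v f : R := \sum_i v 0 i * pderiv (chart_at p) i f p.

Definition pd p f := pdiff (chart_at p) p f.

Lemma near_eq_dd p v f g : {near p, f =1 g} -> dd p v f = dd p v g.
Proof.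
move=> fg; apply: eq_bigr => i _; congr (_ * _).
by apply: near_eq_pderiv => //; exact: chart_atP.
Qed.

Lemma near_eq_pd p f g : {near p, f =1 g} -> pd p f -> pd p g.
Proof. by apply: near_eq_pdiff; exact: chart_atP. Qed.

Lemma dd_diff p v f : pd p f ->
  dd p v f = 'd (f \o param (chart_at p)) (coord (chart_at p) p) v.
Proof. by move=> df; rewrite diff_partial. Qed.

Lemma pd_cst p (c : R) : pd p (fun=> c).
Proof. exact: differentiable_cst. Qed.

Lemma pdD p f g : pd p f -> pd p g -> pd p (fun q => f q + g q).
Proof. exact: differentiableD. Qed.

Lemma pdN p f : pd p f -> pd p (fun q => - f q).
Proof. exact: differentiableN. Qed.

Lemma pdM p f g : pd p f -> pd p g -> pd p (fun q => f q * g q).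
Proof. exact: differentiableM. Qed.

Lemma pd_sum p (I : Type) (s : seq I) (P : pred I) (f : I -> M -> R) :
  (forall i, pd p (f i)) -> pd p (fun q => \sum_(i <- s | P i) f i q).
Proof.
move=> hf; elim: s => [|a s IH].
  by apply: near_eq_pd (pd_cst p 0); near=> q; rewrite big_nil.
case Pa: (P a); last first.
  by apply: near_eq_pd IH; near=> q; rewrite big_cons Pa.
by apply: near_eq_pd (pdD (hf a) IH); near=> q; rewrite big_cons Pa.
Unshelve. all: by end_near. Qed.

Lemma pd_prod p (I : Type) (s : seq I) (P : pred I) (f : I -> M -> R) :
  (forall i, pd p (f i)) -> pd p (fun q => \prod_(i <- s | P i) f i q).
Proof.
move=> hf; elim: s => [|a s IH].
  by apply: near_eq_pd (pd_cst p 1); near=> q; rewrite big_nil.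
case Pa: (P a); last first.
  by apply: near_eq_pd IH; near=> q; rewrite big_cons Pa.
by apply: near_eq_pd (pdM (hf a) IH); near=> q; rewrite big_cons Pa.
Unshelve. all: by end_near. Qed.

Lemma pdV p f : f p != 0 -> pd p f -> pd p (fun q => (f q)^-1).
Proof.
move=> fp df; apply: (@differentiableV _ _ (f \o param _)) => //=.
by rewrite chart_coordK//; exact: chart_atP.
Qed.

Lemma dd_cst p v (c : R) : dd p v (fun=> c) = 0.
Proof.
rewrite dd_diff; last exact: pd_cst.
by rewrite (_ : _ \o _ = cst c)// diff_cst.
Qed.

Lemma ddD p v f g : pd p f -> pd p g ->
  dd p v (fun q => f q + g q) = dd p v f + dd p v g.
Proof.
move=> df dg; rewrite !dd_diff//; last exact: pdD.
by rewrite [LHS](_ : _ = ('d (f \o param (chart_at p)) (coord (chart_at p) p)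
  \+ 'd (g \o param (chart_at p)) (coord (chart_at p) p)) v)// -diffD.
Qed.

Lemma ddM p v f g : pd p f -> pd p g ->
  dd p v (fun q => f q * g q) = dd p v f * g p + f p * dd p v g.
Proof.
move=> df dg; rewrite mulr_suml mulr_sumr -big_split; apply: eq_bigr => i _ /=.
rewrite /pderiv [partial i _ _](partialM i df dg) /=.
by rewrite !chart_coordK; [ring|exact: chart_atP..].
Qed.

Lemma dd_sum p v (I : Type) (s : seq I) (f : I -> M -> R) :
  (forall i, pd p (f i)) ->
  dd p v (fun q => \sum_(i <- s) f i q) = \sum_(i <- s) dd p v (f i).
Proof.
move=> hf; elim: s => [|a s IH].
  rewrite big_nil -[RHS](dd_cst p v 0); apply: near_eq_dd.
  by near=> q; rewrite big_nil.
rewrite big_cons -IH -ddD//; last exact: pd_sum.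
by apply: near_eq_dd; near=> q; rewrite big_cons.
Unshelve. all: by end_near. Qed.

Lemma dd_lin p c v w f : dd p (c *: v + w) f = c * dd p v f + dd p w f.
Proof.
by rewrite mulr_sumr -big_split; apply: eq_bigr => i _; rewrite !mxE /= mulrDl mulrA.
Qed.

Definition dmx p v k l (A : M -> 'M[R]_(k, l)) : 'M[R]_(k, l) :=
  \matrix_(i, j) dd p v (fun q => A q i j).

Definition pdmx p k l (A : M -> 'M[R]_(k, l)) :=
  forall i j, pd p (fun q => A q i j).

Lemma near_eq_dmx p v k l (A B : M -> 'M[R]_(k, l)) :
  {near p, A =1 B} -> dmx p v A = dmx p v B.
Proof.
move=> AB; apply/matrixP => i j; rewrite !mxE; apply: near_eq_dd.
by apply: filterS AB => q ->.
Qed.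

Lemma near_eq_pdmx p k l (A B : M -> 'M[R]_(k, l)) :
  {near p, A =1 B} -> pdmx p A -> pdmx p B.
Proof.
move=> AB dA i j; apply: near_eq_pd (dA i j).
by apply: filterS AB => q ->.
Qed.

Lemma dmx_lin p c v w k l (A : M -> 'M[R]_(k, l)) :
  dmx p (c *: v + w) A = c *: dmx p v A + dmx p w A.
Proof. by apply/matrixP => i j; rewrite !mxE dd_lin. Qed.

Lemma dmxT p v k l (A : M -> 'M[R]_(k, l)) :
  dmx p v (fun q => (A q)^T) = (dmx p v A)^T.
Proof.
apply/matrixP => i j; rewrite !mxE; apply: near_eq_dd.
by near=> q; rewrite mxE.
Unshelve. all: by end_near. Qed.

Lemma pdmxT p k l (A : M -> 'M[R]_(k, l)) :
  pdmx p A -> pdmx p (fun q => (A q)^T).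
Proof.
move=> dA i j; apply: near_eq_pd (dA j i).
by near=> q; rewrite mxE.
Unshelve. all: by end_near. Qed.

Lemma pdmxM p k l h (A : M -> 'M[R]_(k, l)) (B : M -> 'M[R]_(l, h)) :
  pdmx p A -> pdmx p B -> pdmx p (fun q => A q *m B q).
Proof.
move=> dA dB i j.
have := @pd_sum p _ (index_enum 'I_l) predT (fun s q => A q i s * B q s j).
move=> /(_ (fun s => pdM (dA i s) (dB s j))); apply: near_eq_pd.
by near=> q; rewrite mxE.
Unshelve. all: by end_near. Qed.

Lemma dmxM p v k l h (A : M -> 'M[R]_(k, l)) (B : M -> 'M[R]_(l, h)) :
  pdmx p A -> pdmx p B ->
  dmx p v (fun q => A q *m B q) = dmx p v A *m B p + A p *m dmx p v B.
Proof.
move=> dA dB; apply/matrixP => i j; rewrite !mxE -big_split /=.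
rewrite (@near_eq_dd _ _ _ (fun q => \sum_s A q i s * B q s j)); last first.
  by near=> q; rewrite mxE.
rewrite dd_sum; last by move=> s; exact: pdM.
by apply: eq_bigr => s _; rewrite ddM// !mxE.
Unshelve. all: by end_near. Qed.

Lemma dmxZ p v k l f (A : M -> 'M[R]_(k, l)) : pd p f -> pdmx p A ->
  dmx p v (fun q => f q *: A q) = dd p v f *: A p + f p *: dmx p v A.
Proof.
move=> df dA; apply/matrixP => i j; rewrite !mxE -ddM//.
by apply: near_eq_dd; near=> q; rewrite mxE.
Unshelve. all: by end_near. Qed.

Lemma pdmxD p k l (A B : M -> 'M[R]_(k, l)) :
  pdmx p A -> pdmx p B -> pdmx p (fun q => A q + B q).
Proof.
move=> dA dB i j; apply: near_eq_pd (pdD (dA i j) (dB i j)).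
by near=> q; rewrite mxE.
Unshelve. all: by end_near. Qed.

Lemma pdmxN p k l (A : M -> 'M[R]_(k, l)) :
  pdmx p A -> pdmx p (fun q => - A q).
Proof.
move=> dA i j; apply: near_eq_pd (pdN (dA i j)).
by near=> q; rewrite mxE.
Unshelve. all: by end_near. Qed.

Lemma pd_det p k (A : M -> 'M[R]_k) : pdmx p A -> pd p (fun q => \det (A q)).
Proof.
move=> dA; apply: pd_sum => s; apply: pdM; first exact: pd_cst.
by apply: pd_prod => i; exact: dA.
Qed.

(** Cramer's formula. It is used at all points near [p], where the matrices must be invertible
    because [invmx] returns a singular matrix unchanged. *)
Lemma pdmx_invmx p k (A : M -> 'M[R]_k) :
  (\forall q \near p, A q \in unitmx) -> pdmx p A ->
  pdmx p (fun q => invmx (A q)).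
Proof.
move=> uA dA i j.
have h : pd p (fun q => (\det (A q))^-1 * cofactor (A q) j i).
  apply: pdM.
    apply: pdV; last exact: pd_det.
    by have := nbhs_singleton uA; rewrite unitmxE unitfE.
  apply: pdM; first exact: pd_cst.
  apply: pd_det => s t; apply: near_eq_pd (dA (lift j s) (lift i t)).
  by near=> q; rewrite !mxE.
apply: near_eq_pd h; apply: filterS uA => q uq.
by rewrite /invmx uq !mxE.
Unshelve. all: by end_near. Qed.

End PointDerivation.

Lemma dmx_comp (R : realType) (n m : nat) (M : manifold R n) (N : manifold R m)
    (F : M -> N) p v k l (A : N -> 'M[R]_(k, l)) :
  smooth_map F -> pdmx (F p) A ->
  dmx p v (A \o F) = dmx (F p) (v *m dmap F p) A.
Proof.
move=> sF dA; apply/matrixP => i j; rewrite !mxE /dd.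
have ap := chart_atP p; have bp := chart_atP (F p).
under eq_bigr => s _.
  rewrite [pderiv _ _ _ _](pderiv_comp sF ap bp (dA i j)) mulr_sumr; over.
rewrite exchange_big; apply: eq_bigr => t _ /=; rewrite mxE mulr_suml.
by apply: eq_bigr => s _; rewrite !mxE mulrA.
Qed.

Lemma pdmx_comp (R : realType) (n m : nat) (M : manifold R n)
    (N : manifold R m) (F : M -> N) p k l (A : N -> 'M[R]_(k, l)) :
  smooth_map F -> pdmx (F p) A -> pdmx p (A \o F).
Proof.
move=> sF dA i j.
exact: (pdiff_comp sF (chart_atP p) (chart_atP (F p)) (dA i j)).
Qed.

(** * Extension of a tangent vector to a global vector field *)

Section Bump.
Variables (R : realType) (n : nat).
Implicit Types (x y : 'rV[R]_n).

(** Positive exactly on the open Euclidean ball of radius [e] about [x]. Unlike the max norm of row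
    vectors it is polynomial, so its composite with [flat 0] is a smooth bump function. *)
Definition paraboloid (e : R) x y : R := e ^+ 2 - \sum_i (y 0 i - x 0 i) ^+ 2.

Lemma diffk_paraboloid k e x : diffk k setT (paraboloid e x).
Proof.
have oT : open [set: 'rV[R]_n] by exact: openT.
have h : diffk k setT (fun y : 'rV[R]_n =>
    e ^+ 2 + (- 1) * \sum_i (y 0 i + - x 0 i) * (y 0 i + - x 0 i)).
  apply: diffkD => //; first exact: diffk_cst.
  apply: diffkM => //; first exact: diffk_cst.
  apply: diffk_sum => // i.
  by apply: diffkM => //; apply: diffkD => //;
    [exact: diffk_coord|exact: diffk_cst|exact: diffk_coord|exact: diffk_cst].
apply: (diffk_eq oT _ h) => y _; rewrite /paraboloid mulN1r.
by congr (_ - _); apply: eq_bigr => i _; rewrite expr2.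
Qed.

Lemma paraboloid_ball e x y : 0 < e -> 0 <= paraboloid e x y -> `|x - y| <= e.
Proof.
move=> e0; rewrite subr_ge0 => h.
rewrite /Num.Def.normr/= mx_normrE (bigmax_le _ (ltW e0))// => -[i j] _ /=.
rewrite !mxE (ord1 i) distrC -ler_sqr ?nnegrE ?(ltW e0)//.
rewrite -normrX ger0_norm ?sqr_ge0//; apply: le_trans h.
rewrite (bigD1 j)//= lerDl; apply: sumr_ge0 => s _; exact: sqr_ge0.
Qed.

Lemma compact_paraboloid e x : 0 < e -> compact [set y | 0 <= paraboloid e x y].
Proof.
move=> e0; apply: bounded_closed_compact.
  exists (`|x| + e); split; first exact: num_real.
  move=> r hr y /= /(paraboloid_ball e0) h; apply: ltW; apply: le_lt_trans hr.
  by rewrite -[y](subKr x); apply: le_trans (ler_normB _ _) _; rewrite lerD2l.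
have -> : [set y | 0 <= paraboloid e x y] =
    paraboloid e x @^-1` [set t | 0 <= t] by [].
apply: closed_comp; last exact: closed_ge.
move=> y _; apply: differentiable_continuous.
exact: diffk_differentiable (diffk_paraboloid 0 e x) I.
Qed.

End Bump.

Section GlobalField.
Variables (R : realType) (n : nat) (M : manifold R n) (p0 : M) (v : 'rV[R]_n).

Let a := chart_at p0.
Let x0 := coord a p0.

Variable e : R.
Hypothesis e0 : 0 < e.
Hypothesis img_e : forall y, `|x0 - y| <= e -> (coord a @` dom a) y.

Definition bump_field : vfield M := fun q =>
  if q \in dom a then
    (flat 0 (paraboloid e x0 (coord a q)) / flat 0 (paraboloid e x0 x0))
      *: (v *m trans a (chart_at q) q)
  else 0.

(** The image of the compact ball is compact, hence closed because the manifold is Hausdorff. The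
    field therefore vanishes on a neighbourhood of every point outside the chart domain, and
    extension by 0 is smooth there. *)
Let closed_supp : closed (param a @` [set y | 0 <= paraboloid e x0 y]).
Proof.
apply: compact_closed; first exact: hausdorff_pt.
apply: continuous_compact; last exact: compact_paraboloid.
apply: continuous_in_subspaceT => y /set_mem /= /(paraboloid_ball e0) hy.
exact: chart_param_continuous (img_e hy).
Qed.

Let supp0 q : ~ (param a @` [set y | 0 <= paraboloid e x0 y]) q ->
  bump_field q = 0.
Proof.
move=> hq; rewrite /bump_field; case: ifPn => // /set_mem aq.
rewrite {1}/flat ifF ?mul0r ?scale0r//; apply/negbTE/negP => h; apply: hq.
by exists (coord a q); rewrite /= ?(ltW h)// chart_coordK.
Qed.

Lemma bump_field_at : bump_field p0 = v.
Proof.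
have ap : dom a p0 by exact: chart_atP.
rewrite /bump_field mem_set// trans_id// mulmx1 -/x0 divff ?scale1r//.
rewrite /flat /paraboloid big1 ?subr0; last by move=> i _; rewrite subrr expr0n.
by rewrite exprn_gt0// expr0 mul1r gt_eqF ?expR_gt0.
Qed.

Lemma bump_field_smooth : vfield_on setT bump_field.
Proof.
move=> b k c s x [q [cq [_ bq]] <-{x}].
have [/= aq|aq] := pselect (dom a q); last first.
  pose C := param a @` [set y | 0 <= paraboloid e x0 y].
  have oU : open (coord c @` (dom c `&` ~` C)).
    exact: open_chart_image (closed_openC closed_supp).
  have nC : ~ C q.
    move=> [y /= /(paraboloid_ball e0)/img_e[q' aq' <-] E].
    by apply: aq; rewrite -E chart_coordK.
  have h : smooth_on (coord c @` (dom c `&` ~` C)) (fun=> 0 : R).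
    by apply/smooth_diffk => N; exact: diffk_cst.
  apply: (smooth_on_eq oU _ h); last by exists q.
  move=> y /set_mem[q' [cq' nC'] <-] /=; rewrite chart_coordK//.
  by rewrite supp0// /vec_in mul0mx mxE.
pose V := coord a @` (dom a `&` dom b).
(* [H] is the [k]-th component of the field in the chart [b], as a function of the coordinates of
   [a]; a transition map then carries it to the chart [c]. *)
pose H (y : 'rV[R]_n) : R :=
  flat 0 (paraboloid e x0 y) / flat 0 (paraboloid e x0 x0) *
  \sum_i v 0 i * partial i (fun z => coord b (param a z) 0 k) y.
have oV : open V by apply: open_chart_image; exact: open_chart_dom.
have sH : smooth_on V H.
  apply: smooth_onM => //.
    apply: smooth_onM => //; last by apply/smooth_diffk => N; exact: diffk_cst.
    apply: (@smooth_on_sub _ _ setT) => //.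
    apply/smooth_diffk => N; apply: diffk_flat; first exact: openT.
    by move=> N'; exact: diffk_paraboloid.
  apply/smooth_diffk => N; apply: diffk_sum => // i.
  apply: diffkM => //; first exact: diffk_cst.
  have := smooth_on_partial i (@smooth_transition _ _ M a b k).
  by move=> /smooth_diffk; apply.
pose U := coord c @` (dom c `&` (dom a `&` dom b)).
have oU : open U.
  by apply: open_chart_image; apply: openI; exact: open_chart_dom.
have sG : smooth_on U (H \o (fun x => coord a (param c x))).
  apply: (smooth_on_comp oU) sH.
    by move=> _ [q' [cq' [aq' bq']] <-]; rewrite chart_coordK//; exists q'.
  move=> j; apply: (smooth_on_sub _ (@smooth_transition _ _ M c a j)).
  by move=> _ [q' [cq' [aq' bq']] <-]; exists q'.
apply: (smooth_on_eq oU _ sG); last by exists q.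
move=> _ /set_mem[q' [cq' [aq' bq']] <-] /=; rewrite chart_coordK//.
rewrite /bump_field mem_set// /vec_in -scalemxAl -mulmxA trans_comp//; last first.
  exact: chart_atP.
rewrite !mxE /H; congr (_ * _); apply: eq_bigr => i _.
by rewrite mxE.
Qed.

End GlobalField.

Lemma vfield_extension (R : realType) (n : nat) (M : manifold R n) (p : M)
    (v : 'rV[R]_n) : exists2 X : vfield M, vfield_on setT X & X p = v.
Proof.
have [d /= d0 hd] := (nbhs_ballP _ _).1 (near_img (chart_atP p)).
have e0 : 0 < d / 2 by rewrite divr_gt0.
have he y : `|coord (chart_at p) p - y| <= d / 2 ->
    (coord (chart_at p) @` dom (chart_at p)) y.
  move=> hy; apply: hd; rewrite -ball_normE /=; apply: le_lt_trans hy _.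
  by rewrite ltr_pdivrMr// ltr_pMr// ltr1n.
exists (bump_field p v (d / 2)); first exact: bump_field_smooth.
exact: bump_field_at.
Qed.

(** * Levi-Civita connections and the Gauss formula *)

Section Form.
Variable R : realType.

Definition bform k l (A : 'M[R]_(k, l)) (u : 'rV[R]_k) (w : 'rV[R]_l) : R :=
  (u *m A *m w^T) 0 0.

Section Linearity.
Variables (k l : nat) (A B : 'M[R]_(k, l)).
Implicit Types (u : 'rV[R]_k) (w : 'rV[R]_l).

Lemma bformDl u u' w : bform A (u + u') w = bform A u w + bform A u' w.
Proof. by rewrite /bform !mulmxDl mxE. Qed.

Lemma bformNl u w : bform A (- u) w = - bform A u w.
Proof. by rewrite /bform !mulNmx mxE. Qed.

Lemma bformZl c u w : bform A (c *: u) w = c * bform A u w.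
Proof. by rewrite /bform -!scalemxAl mxE. Qed.

Lemma bformDr u w w' : bform A u (w + w') = bform A u w + bform A u w'.
Proof. by rewrite /bform linearD mulmxDr mxE. Qed.

Lemma bformNr u w : bform A u (- w) = - bform A u w.
Proof. by rewrite /bform linearN mulmxN mxE. Qed.

Lemma bformD u w : bform (A + B) u w = bform A u w + bform B u w.
Proof. by rewrite /bform mulmxDr mulmxDl mxE. Qed.

Lemma bformN u w : bform (- A) u w = - bform A u w.
Proof. by rewrite /bform mulmxN mulNmx mxE. Qed.

Lemma bformZ c u w : bform (c *: A) u w = c * bform A u w.
Proof. by rewrite /bform -scalemxAr -scalemxAl mxE. Qed.

Lemma bformT u w : bform A^T w u = bform A u w.
Proof.
rewrite /bform; transitivity ((u *m A *m w^T)^T 0 0); last by rewrite mxE.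
by rewrite !trmx_mul trmxK mulmxA.
Qed.

Lemma bform_sum u w : bform A u w = \sum_i \sum_j u 0 i * A i j * w 0 j.
Proof.
rewrite /bform mxE exchange_big; apply: eq_bigr => j _ /=.
by rewrite !mxE mulr_suml.
Qed.

End Linearity.

Lemma bform_mulmx k k' l l' (A : 'M[R]_(k, l)) (L : 'M[R]_(k', k))
    (L' : 'M[R]_(l', l)) u w :
  bform (L *m A *m L'^T) u w = bform A (u *m L) (w *m L').
Proof. by rewrite /bform trmx_mul !mulmxA. Qed.

Lemma bform_inj k (A : 'M[R]_k) u u' : A \in unitmx ->
  (forall w, bform A u w = bform A u' w) -> u = u'.
Proof.
move=> uA h; apply/(can_inj (mulmxK uA))/rowP => j.
have E (x : 'rV[R]_k) : (x *m A) 0 j = bform A x (delta_mx 0 j).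
  rewrite /bform [RHS]mxE (bigD1 j)//= big1 ?addr0.
    by rewrite [(_^T) _ _]mxE [delta_mx _ _ _ _]mxE !eqxx mulr1.
  move=> i ij; rewrite [(_^T) _ _]mxE [delta_mx _ _ _ _]mxE eqxx.
  by rewrite (negPf ij) mulr0.
by rewrite !E h.
Qed.

Definition is_inner k (A : 'M[R]_k) :=
  A^T = A /\ forall v, v != 0 -> 0 < bform A v v.

Lemma inner_unit k (A : 'M[R]_k) : is_inner A -> A \in unitmx.
Proof.
move=> [_ pA]; rewrite -row_free_unit -kermx_eq0; apply/eqP/row_matrixP => i.
rewrite row0; apply/eqP; apply: contraT => /pA.
have -> : bform A (row i (kermx A)) (row i (kermx A)) = 0.
  by rewrite /bform -row_mul mulmx_ker row0 mul0mx mxE.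
by rewrite ltxx.
Qed.

Lemma inner_sym k (A : 'M[R]_k) u w : is_inner A -> bform A u w = bform A w u.
Proof. by move=> [sA _]; rewrite -bformT sA. Qed.

Lemma inner_pullback k l (A : 'M[R]_l) (L : 'M[R]_(k, l)) :
  is_inner A -> row_free L -> is_inner (L *m A *m L^T).
Proof.
move=> [sA pA] fL; split; first by rewrite !trmx_mul trmxK sA mulmxA.
by move=> v v0; rewrite bform_mulmx pA// mulmx_free_eq0.
Qed.

End Form.

Section Connection.
Variables (R : realType) (n : nat) (M : manifold R n).
Implicit Types (p q : M) (g : bilfield M) (X Y Z : vfield M).
Implicit Types (u v w z : 'rV[R]_n).

Definition vec_comp p X := fun q => vec_in (chart_at p) q (X q).
Definition bil_comp p g := fun q => bil_in (chart_at p) q (g q).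
Definition end_comp p (L : endfield M) := fun q => end_in (chart_at p) q (L q).

(* The zeroth-order part of nabla_u w in the chart [chart_at p]. *)
Definition gam g p u w : 'rV[R]_n :=
  \row_k \sum_i \sum_j christoffel g p k i j * u 0 i * w 0 j.

Definition cov g p u Y : 'rV[R]_n := dmx p u (vec_comp p Y) + gam g p u (Y p).

Lemma nablaE g X Y p : nabla g X Y p = cov g p (X p) Y.
Proof. by apply/rowP => k; rewrite !mxE. Qed.

Lemma vec_comp_at p X : vec_comp p X p = X p.
Proof. by rewrite /vec_comp /vec_in trans_id ?mulmx1//; exact: chart_atP. Qed.

Lemma bil_comp_at p g : bil_comp p g p = g p.
Proof.
by rewrite /bil_comp /bil_in trans_id ?mul1mx ?trmx1 ?mulmx1//; exact: chart_atP.
Qed.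

Lemma end_comp_at p L : end_comp p L p = L p.
Proof.
by rewrite /end_comp /end_in trans_id ?mul1mx ?mulmx1//; exact: chart_atP.
Qed.

Lemma near_ip p g Y Z : {near p, (fun q => ip g q (Y q) (Z q)) =1
  (fun q => (vec_comp p Y q *m bil_comp p g q *m (vec_comp p Z q)^T) 0 0)}.
Proof.
apply: filterS (near_dom (chart_atP p)) => q aq.
rewrite /vec_comp /bil_comp /vec_in /bil_in /ip; congr (fun_of_matrix _ 0 0).
rewrite trmx_mul !mulmxA -(mulmxA (Y q) (trans _ _ _)) transV ?mulmx1//; last exact: chart_atP.
rewrite -(mulmxA (Y q *m g q)) -trmx_mul transV ?trmx1 ?mulmx1//.
exact: chart_atP.
Qed.

Lemma near_apply_end p (L : endfield M) Y :
  {near p, vec_comp p (apply_end L Y) =1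
           (fun q => vec_comp p Y q *m end_comp p L q)}.
Proof.
apply: filterS (near_dom (chart_atP p)) => q aq.
rewrite /vec_comp /end_comp /vec_in /end_in /apply_end.
rewrite !mulmxA -(mulmxA (Y q) (trans _ _ _)) transV ?mulmx1//.
exact: chart_atP.
Qed.

Lemma bform_dmx_bil g p u w z :
  bform (dmx p u (bil_comp p g)) w z =
  \sum_s \sum_i \sum_j u 0 s *
    (pderiv (chart_at p) s (fun q => bil_in (chart_at p) q (g q) i j) p)
    * w 0 i * z 0 j.
Proof.
rewrite bform_sum [RHS]exchange_big /=; apply: eq_bigr => i _.
rewrite [RHS]exchange_big /=; apply: eq_bigr => j _.
rewrite mxE /dd mulr_sumr mulr_suml; apply: eq_bigr => s _.
by rewrite -mulrA mulrCA -!mulrA; congr (_ * _); rewrite mulrCA.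
Qed.

(* Koszul formula. *)
Lemma gam_low g p u w z : is_inner (g p) ->
  bform (g p) (gam g p u w) z = 2^-1 *
    (bform (dmx p u (bil_comp p g)) w z + bform (dmx p w (bil_comp p g)) u z
     - bform (dmx p z (bil_comp p g)) u w).
Proof.
move=> ig; have ug := inner_unit ig; have [sg _] := ig.
pose dg s i j :=
  pderiv (chart_at p) s (fun q => bil_in (chart_at p) q (g q) i j) p.
(* [C] is twice the Christoffel symbols of the first kind contracted with [u] and [w]; raising its
   index by the inverse metric gives [gam]. *)
pose C : 'rV[R]_n := \row_l \sum_i \sum_j
  (dg i j l + dg j i l - dg l i j) * u 0 i * w 0 j.
have -> : gam g p u w = 2^-1 *: (C *m invmx (g p)).
  apply/rowP => k; rewrite !mxE.
  rewrite [in RHS](eq_bigr (fun l => \sum_i \sum_j invmx (g p) k l *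
     ((dg i j l + dg j i l - dg l i j) * u 0 i * w 0 j))); last first.
    move=> l _; rewrite mxE mulr_suml; apply: eq_bigr => i _.
    rewrite mulr_suml; apply: eq_bigr => j _; rewrite mulrC; congr (_ * _).
    by rewrite -[in LHS]sg -trmx_inv mxE.
  rewrite [in RHS]exchange_big mulr_sumr; apply: eq_bigr => i _ /=.
  rewrite [in RHS]exchange_big mulr_sumr; apply: eq_bigr => j _ /=.
  rewrite /christoffel -!mulrA; congr (_ * _); rewrite mulr_suml.
  by apply: eq_bigr => l _ /=; rewrite !mulrA.
rewrite bformZl; congr (_ * _); rewrite {1}/bform mulmxKV//.
transitivity (\sum_i \sum_j \sum_l
  (dg i j l + dg j i l - dg l i j) * u 0 i * w 0 j * z 0 l).
  rewrite mxE; under [RHS]eq_bigr do rewrite exchange_big /=.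
  rewrite [RHS]exchange_big /=; apply: eq_bigr => l _.
  rewrite !mxE mulr_suml; apply: eq_bigr => i _.
  by rewrite mulr_suml.
rewrite !bform_dmx_bil.
rewrite [X in _ + X - _]exchange_big /=.
rewrite [X in _ - X](exchange_big) /=.
under [X in _ - X]eq_bigr do rewrite exchange_big /=.
rewrite -big_split -sumrB; apply: eq_bigr => i _ /=.
rewrite -big_split -sumrB; apply: eq_bigr => j _ /=.
rewrite -big_split -sumrB; apply: eq_bigr => l _ /=.
by rewrite -/(dg _ _ _) -/(dg j i l) -/(dg l i j); ring.
Qed.

Lemma dmx_bil_sym g p u w z : (\forall q \near p, (g q)^T = g q) ->
  bform (dmx p u (bil_comp p g)) w z = bform (dmx p u (bil_comp p g)) z w.
Proof.
move=> sg; suff E : (dmx p u (bil_comp p g))^T = dmx p u (bil_comp p g).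
  by rewrite -[LHS]bformT E.
rewrite -dmxT; apply: near_eq_dmx.
by apply: filterS sg => q sq; rewrite /bil_comp /bil_in !trmx_mul trmxK sq mulmxA.
Qed.

Lemma gamC g p u w : is_inner (g p) -> (\forall q \near p, (g q)^T = g q) ->
  gam g p u w = gam g p w u.
Proof.
move=> ig sg; apply: (bform_inj (inner_unit ig)) => z; rewrite !gam_low//.
by rewrite (dmx_bil_sym z u w sg); ring.
Qed.

Lemma gamDl g p u u' w :
  gam g p (u + u') w = gam g p u w + gam g p u' w.
Proof.
apply/rowP => k; rewrite !mxE -big_split; apply: eq_bigr => i _ /=.
rewrite -big_split; apply: eq_bigr => j _ /=; rewrite mxE; ring.
Qed.

Lemma covDl g p u u' Y :
  cov g p (u + u') Y = cov g p u Y + cov g p u' Y.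
Proof.
rewrite /cov gamDl -[u in dmx p (u + _)]scale1r dmx_lin scale1r.
by rewrite addrACA.
Qed.

(** Vanishing torsion: the [gam] terms are symmetric and cancel. *)
Lemma bracketE g X Y p : is_inner (g p) -> (\forall q \near p, (g q)^T = g q) ->
  bracket X Y p = cov g p (X p) Y - cov g p (Y p) X.
Proof.
move=> ig sg; rewrite /cov (gamC (Y p))// opprD addrACA subrr addr0.
by apply/rowP => k; rewrite !mxE.
Qed.

(** In the sum of the two Koszul formulas everything cancels except the derivative of the metric
    along [u]. *)
Lemma metric_compat g p u Y Z : is_inner (g p) ->
  (\forall q \near p, (g q)^T = g q) -> pdmx p (bil_comp p g) ->
  pdmx p (vec_comp p Y) -> pdmx p (vec_comp p Z) ->
  dd p u (fun q => ip g q (Y q) (Z q)) =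
  bform (g p) (cov g p u Y) (Z p) + bform (g p) (Y p) (cov g p u Z).
Proof.
move=> ig sg dg dY dZ; rewrite (near_eq_dd _ (near_ip p g Y Z)).
have -> : forall A : M -> 'M[R]_1, dd p u (fun q => A q 0 0) = dmx p u A 0 0.
  by move=> A; rewrite mxE.
rewrite dmxM; [|exact: pdmxM|exact: pdmxT].
rewrite dmxM// dmxT vec_comp_at vec_comp_at bil_comp_at.
rewrite mxE mulmxDl mxE -!/(bform _ _ _) /cov bformDl bformDr.
rewrite (inner_sym (Y p) (gam _ _ _ _))// !gam_low//.
by rewrite (dmx_bil_sym u (Z p) (Y p) sg); field.
Qed.

End Connection.

(** * The tangential part of the ambient derivative along an immersion *)

Section Gauss.
Variables (R : realType) (n m : nat) (M : manifold R n) (N : manifold R m).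
Variables (F : M -> N) (gN : bilfield N).
Hypothesis sF : smooth_map F.
Implicit Types (p : M) (Y : vfield M) (W : M -> 'rV[R]_m).

Definition along_comp p W : M -> 'rV[R]_m :=
  fun q => vec_in (chart_at (F p)) (F q) (W q).

Definition cov_along p (u : 'rV[R]_n) W : 'rV[R]_m :=
  dmx p u (along_comp p W) + gam gN (F p) (u *m dmap F p) (W p).

Lemma nabla_alongE X W p : nabla_along F gN X W p = cov_along p (X p) W.
Proof. by apply/rowP => k; rewrite !mxE. Qed.

(** The charts of [p] and [F p] stay fixed while the point varies, so this matrix, unlike [dmap F],
    can be differentiated at [p]. *)
Definition jacF p : M -> 'M[R]_(n, m) :=
  jac F (chart_at p) (chart_at (F p)).

Lemma near_jac_partial p i j :
  {near coord (chart_at p) p,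
    partial i ((fun q => coord (chart_at (F p)) (F q) 0 j) \o param (chart_at p))
    =1 (fun q => jacF p q i j) \o param (chart_at p)}.
Proof.
apply: filterS (near_img (chart_atP p)) => x ix /=.
by rewrite mxE /pderiv chart_paramK.
Qed.

Lemma smooth_coord_map p j :
  let S := coord (chart_at p) @` (dom (chart_at p) `&`
             F @^-1` dom (chart_at (F p))) in
  [/\ open S, S (coord (chart_at p) p) & smooth_on S
    ((fun q => coord (chart_at (F p)) (F q) 0 j) \o param (chart_at p))].
Proof.
have [Fc Fs] := sF; split; last exact: Fs.
  apply: open_chart_image; apply: open_comp; first by move=> ? _; exact: Fc.
  exact: open_chart_dom.
by exists p => //; split; exact: chart_atP.
Qed.

Lemma pdmx_jacF p : pdmx p (jacF p).
Proof.
move=> i j; apply: near_eq_differentiable (near_jac_partial p i j) _.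
have [_ Sp sS] := smooth_coord_map p j.
exact: smooth_on_differentiable (smooth_on_partial i sS) Sp.
Qed.

Lemma jacF_at p : jacF p p = dmap F p.
Proof. by []. Qed.

(** Both sides are the second derivative of the coordinate expression of [F] in the directions [u]
    and [w]; this is Schwarz's theorem. *)
Lemma dmx_jacFC p (u w : 'rV[R]_n) :
  w *m dmx p u (jacF p) = u *m dmx p w (jacF p).
Proof.
apply/rowP => j; have [oS Sp sS] := smooth_coord_map p j; rewrite !mxE.
have E s i : pderiv (chart_at p) s (fun q => jacF p q i j) p =
    partial s (partial i ((fun q => coord (chart_at (F p)) (F q) 0 j)
                           \o param (chart_at p))) (coord (chart_at p) p).
  by rewrite /pderiv (near_eq_partial _ (near_jac_partial p i j)).
under eq_bigr do rewrite mxE /dd mulr_sumr.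
under [RHS]eq_bigr do rewrite mxE /dd mulr_sumr.
rewrite exchange_big; apply: eq_bigr => s _; apply: eq_bigr => i _ /=.
by rewrite !E (partialC _ _ oS sS Sp) mulrCA.
Qed.

Lemma near_bil_induced p : {near p, bil_comp p (induced_metric F gN) =1
  (fun q => jacF p q *m (bil_comp (F p) gN \o F) q *m (jacF p q)^T)}.
Proof.
apply: filterS2 (near_dom (chart_atP p)) (smooth_map_near sF (chart_atP (F p))).
move=> q aq bq; rewrite /bil_comp /bil_in /induced_metric /=.
rewrite !mulmxA trans_jac//; [|exact: chart_atP..].
rewrite jac_trans//; last exact: chart_atP.
rewrite -mulmxA -trmx_mul trans_jac//; [|exact: chart_atP..].
by rewrite -[in RHS]mulmxA -trmx_mul jac_trans//; exact: chart_atP.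
Qed.

Lemma near_along_push p Y :
  {near p, along_comp p (push F Y) =1 (fun q => vec_comp p Y q *m jacF p q)}.
Proof.
apply: filterS2 (near_dom (chart_atP p)) (smooth_map_near sF (chart_atP (F p))).
move=> q aq bq; rewrite /along_comp /vec_comp /vec_in /push.
rewrite -!mulmxA trans_jac//; last exact: chart_atP.
by rewrite jac_trans//; exact: chart_atP.
Qed.

Lemma near_along_end p (J : endfield N) W :
  {near p, along_comp p (fun q => W q *m J (F q)) =1
    (fun q => along_comp p W q *m (end_comp (F p) J \o F) q)}.
Proof.
apply: filterS (smooth_map_near sF (chart_atP (F p))) => q bq.
rewrite /along_comp /end_comp /vec_in /end_in /=.
rewrite !mulmxA -(mulmxA (W q) (trans _ _ _)) transV ?mulmx1//.
exact: chart_atP.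
Qed.

Hypothesis iN : forall y, is_inner (gN y).
Hypothesis dN : forall y, pdmx y (bil_comp y gN).

Lemma pdmx_induced p : pdmx p (bil_comp p (induced_metric F gN)).
Proof.
apply: (near_eq_pdmx (A := fun q =>
  jacF p q *m (bil_comp (F p) gN \o F) q *m (jacF p q)^T)).
  by apply: filterS (near_bil_induced p).
apply: pdmxM; last by apply: pdmxT; exact: pdmx_jacF.
by apply: pdmxM; [exact: pdmx_jacF|exact: pdmx_comp].
Qed.

Lemma pdmx_push p Y : pdmx p (vec_comp p Y) -> pdmx p (along_comp p (push F Y)).
Proof.
move=> dY; apply: (near_eq_pdmx (A := fun q => vec_comp p Y q *m jacF p q)).
  by apply: filterS (near_along_push p Y).
by apply: pdmxM => //; exact: pdmx_jacF.
Qed.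

Lemma bform_dmx_induced p u w z :
  bform (dmx p u (bil_comp p (induced_metric F gN))) w z =
    bform (gN (F p)) (w *m dmx p u (jacF p)) (z *m dmap F p)
  + bform (dmx (F p) (u *m dmap F p) (bil_comp (F p) gN))
         (w *m dmap F p) (z *m dmap F p)
  + bform (gN (F p)) (w *m dmap F p) (z *m dmx p u (jacF p)).
Proof.
rewrite (near_eq_dmx _ (near_bil_induced p)).
have dB := pdmx_comp sF (dN (F p)); have dJ := @pdmx_jacF p.
rewrite dmxM; [|exact: pdmxM|exact: pdmxT].
rewrite dmxM// dmxT dmx_comp// /= bil_comp_at jacF_at.
by rewrite mulmxDl !bformD !bform_mulmx.
Qed.

(* The terms with second derivatives of F in the Koszul formula of the induced
   metric cancel because these derivatives commute. *)
Lemma gauss_formula p u Y z : row_free (dmap F p) ->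
  pdmx p (vec_comp p Y) ->
  bform (gN (F p)) (cov_along p u (push F Y)) (z *m dmap F p) =
  bform (induced_metric F gN p) (cov (induced_metric F gN) p u Y) z.
Proof.
move=> fL dY; have iM := inner_pullback (iN (F p)) fL.
rewrite /cov_along (near_eq_dmx _ (near_along_push p Y)).
rewrite dmxM//; last exact: pdmx_jacF.
rewrite vec_comp_at jacF_at /cov !bformDl !gam_low//.
rewrite [bform (induced_metric _ _ _) (dmx _ _ _) _]bform_mulmx.
rewrite !bform_dmx_induced /push.
rewrite (dmx_jacFC p z u) (dmx_jacFC p z (Y p)) (dmx_jacFC p (Y p) u).
rewrite !(inner_sym (u *m dmap F p) _ (iN _)).
by rewrite !(inner_sym (Y p *m dmap F p) _ (iN _)); field.
Qed.

End Gauss.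

(** * Locally conformal Kahler metrics *)

Section Conformal.
Variables (R : realType) (n : nat) (M : manifold R n).
Implicit Types (p q : M) (g : bilfield M) (u v w z b : 'rV[R]_n).

Lemma inner_scale k (A : 'M[R]_k) c : 0 < c -> is_inner A -> is_inner (c *: A).
Proof.
move=> c0 [sA pA]; split; first by rewrite linearZ /= sA.
by move=> v v0; rewrite bformZ mulr_gt0// pA.
Qed.

Lemma dd_expRN p v (f : M -> R) : pd p f ->
  dd p v (fun q => expR (- f q)) = - (expR (- f p) * dd p v f).
Proof.
move=> df; rewrite /dd mulr_sumr -sumrN; apply: eq_bigr => i _.
rewrite /pderiv.
have fp : (f \o param (chart_at p)) (coord (chart_at p) p) = f p.
  by rewrite /= chart_coordK//; exact: chart_atP.
have de (t : R) : is_derive t (1 : R) (fun s => expR (- s)) (- expR (- t)).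
  have H := @is_derive1_comp R expR -%R t _ _ _ (is_deriveNid t 1).
  by apply: is_derive_eq; rewrite mulrN1.
rewrite [partial _ _ _](partial_comp1 i df (de _)) fp; ring.
Qed.

Lemma pd_expRN p (f : M -> R) : pd p f -> pd p (fun q => expR (- f q)).
Proof.
move=> df; apply: (@differentiable_comp _ _ _ _ (fun x => - f (param _ x)) expR).
  exact: differentiableN df.
exact/derivable1_diffP/derivable_expR.
Qed.

(** The classical conformal change of the Levi-Civita connection, [b] being the gradient of [f]. The
    derivative of exp(-f) g is exp(-f)(dg - df g), so the exponential factors out of the Koszul
    formula and each remaining df yields one of the three correction terms. *)
Lemma gam_conformal g (f : M -> R) p u w b : is_inner (g p) ->
  pdmx p (bil_comp p g) -> pd p f -> (forall v, bform (g p) v b = dd p v f) ->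
  gam (fun q => expR (- f q) *: g q) p u w =
  gam g p u w - 2^-1 *: (dd p w f *: u + dd p u f *: w - bform (g p) u w *: b).
Proof.
move=> ig dg df hb; set g' := fun q => _.
have e0 := expR_gt0 (- f p).
have ig' : is_inner (g' p) by exact: inner_scale.
have dE v : dmx p v (bil_comp p g') =
    expR (- f p) *: (dmx p v (bil_comp p g) - dd p v f *: g p).
  rewrite (@near_eq_dmx _ _ _ _ _ _ _ _
    (fun q => expR (- f q) *: bil_comp p g q)); last first.
    near=> q; rewrite /bil_comp /bil_in /g'.
    by rewrite -scalemxAr -scalemxAl.
  rewrite dmxZ//; last exact: pd_expRN.
  by rewrite bil_comp_at dd_expRN// scalerBr scalerA scaleNr addrC.
apply: (bform_inj (inner_unit ig)) => z.
apply: (mulfI (lt0r_neq0 e0)); rewrite -bformZ.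
rewrite [bform _ _ _](gam_low u w z ig') !dE !bformZ.
rewrite !(bformDl, bformNl, bformZl) gam_low// !(bformD, bformN, bformZ).
by rewrite -(hb z) (inner_sym z b ig); ring.
Unshelve. all: by end_near. Qed.

End Conformal.

Section LCK.
Variables (R : realType) (m : nat) (N : manifold R m).
Variables (J : endfield N) (g : bilfield N).

Lemma metric_on_inner p : metric_on setT g -> is_inner (g p).
Proof. by move=> [sg pg _]; split; [exact: sg|exact: pg]. Qed.

Lemma metric_on_pdmx p : metric_on setT g -> pdmx p (bil_comp p g).
Proof.
move=> [_ _ dg] i j; apply: smooth_fun_pdiff (dg (chart_at p) i j) _ _;
  [split=> //=|]; exact: chart_atP.
Qed.

Lemma almost_hermitian_pdmx p : almost_hermitian_on setT J g ->
  pdmx p (end_comp p J).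
Proof.
move=> [_ dJ _ _] i j; apply: smooth_fun_pdiff (dJ (chart_at p) i j) _ _;
  [split=> //=|]; exact: chart_atP.
Qed.

Lemma vfield_on_pdmx (U : set N) p X : vfield_on U X -> U p ->
  pdmx p (vec_comp p X).
Proof.
move=> sX Up i j; rewrite (ord1 i).
apply: smooth_fun_pdiff (sX (chart_at p) j) _ _; [split=> //=|];
  exact: chart_atP.
Qed.

(* The components of (nabla_u J) w. *)
Definition tensorJ p (u w : 'rV[R]_m) : 'rV[R]_m :=
  w *m dmx p u (end_comp p J) + gam g p u (w *m J p) - gam g p u w *m J p.

(** On [U] the structure J commutes with the connection of exp(-f) g. Substituting [gam_conformal]
    on both sides, the two terms df(u) Jw cancel and the others form the right-hand side. *)
Lemma lck_tensorJ p (U : set N) (f : N -> R) (b u w : 'rV[R]_m) :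
  almost_hermitian_on setT J g -> lck_potential J g U f -> U p ->
  (forall v, bform (g p) v b = dd p v f) ->
  tensorJ p u w = 2^-1 *:
    (dd p (w *m J p) f *: u - dd p w f *: (u *m J p)
     - bform (g p) u (w *m J p) *: b + bform (g p) u w *: (b *m J p)).
Proof.
move=> hJ [oU _ sf [hK nJ]] Up hb.
have [mg _ _ _] := hJ.
have ig := metric_on_inner p mg; have dg := metric_on_pdmx p mg.
have dJ := almost_hermitian_pdmx p hJ.
have df : pd p f by apply: smooth_fun_pdiff sf Up _; exact: chart_atP.
(* The Kähler condition is stated for vector fields, so [u] and [w] are extended. *)
have [X sX Xp] := vfield_extension p u; have [Y sY Yp] := vfield_extension p w.
have onU Z : vfield_on setT Z -> vfield_on U Z.
  move=> sZ c k; apply: smooth_fun_sub (sZ c k) => q [_ cq]; by split.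
have := nJ _ _ (onU _ sX) (onU _ sY) p Up.
rewrite nablaE {2}/apply_end nablaE Xp /cov.
rewrite (near_eq_dmx _ (near_apply_end p J Y)) dmxM//; last first.
  exact: vfield_on_pdmx sY I.
rewrite end_comp_at vec_comp_at /apply_end Yp mulmxDl.
rewrite !(gam_conformal _ _ ig dg df hb) /tensorJ.
rewrite mulmxBl -scalemxAl mulmxBl mulmxDl -!scalemxAl.
move: (dmx p u (vec_comp p Y) *m J p) (w *m dmx _ _ _) => y1 y2.
move: (gam _ _ _ (w *m _)) (gam _ _ _ _ *m _) (b *m J p) => y3 y4 y5.
move: (dd p _ f) (dd p _ f) (dd p _ f) (bform _ _ _) (bform _ _ _) => c1 c2 c3 c4 c5.
move: (u *m J p) (w *m J p) => y6 y7 E; apply/rowP => j.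
by have := congr1 (fun t : 'rV_m => t 0 j) E; rewrite !mxE; lra.
Qed.

End LCK.

(** * Orthogonal complements and bundle-like metrics *)

Section Orthogonal.
Variables (R : realType) (n : nat) (A : 'M[R]_n).
Hypothesis iA : is_inner A.

(** Pointwise form of [orth], for any row space: [orth g D p], the normal space and the second
    factor of [mu] are all instances by conversion. *)
Definition orthm k (D : 'M[R]_(k, n)) : 'M[R]_n := kermx (A *m D^T).

Lemma orthmP k (D : 'M[R]_(k, n)) (x : 'rV[R]_n) :
  (forall d : 'rV[R]_n, (d <= D)%MS -> bform A x d = 0) <-> (x <= orthm D)%MS.
Proof.
split=> [h|/sub_kermxP h _ /submxP[c ->]].
  apply/sub_kermxP/rowP => j; rewrite mulmxA mxE [RHS]mxE.
  rewrite -[RHS](h _ (row_sub j D)) /bform [RHS]mxE.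
  by apply: eq_bigr => i _; rewrite !mxE.
by rewrite /bform trmx_mul !mulmxA -(mulmxA x) h mul0mx mxE.
Qed.

Lemma rank_orthm k (D : 'M[R]_(k, n)) : \rank (orthm D) = (n - \rank D)%N.
Proof.
rewrite mxrank_ker -mxrank_tr trmx_mul trmxK mxrankMfree//.
by rewrite row_free_unit unitmx_tr; exact: inner_unit.
Qed.

Lemma cap_orthm k (D : 'M[R]_(k, n)) : (D :&: orthm D)%MS = 0.
Proof.
apply/eqP; rewrite -submx0; apply/row_subP => i.
have := row_sub i (D :&: orthm D)%MS; rewrite sub_capmx => /andP[xD xO].
have E := (orthmP _ _).2 xO _ xD; have [_ pA] := iA.
have [->|/pA] := eqVneq (row i (D :&: orthm D)%MS) 0; first exact: sub0mx.
by rewrite E ltxx.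
Qed.

Lemma add_orthm k (D : 'M[R]_(k, n)) (x : 'rV[R]_n) : (x <= D + orthm D)%MS.
Proof.
apply: submx_full; rewrite /row_full; apply/eqP.
have := mxrank_sum_cap D (orthm D); rewrite cap_orthm !mxrank0 addn0 => ->.
by rewrite rank_orthm subnKC ?rank_leq_col.
Qed.

(** One inclusion and equality of ranks. It is needed because the distribution transversal to the
    leaves appears as the double complement of D. *)
Lemma orthmK k (D : 'M[R]_(k, n)) : (orthm (orthm D) :=: D)%MS.
Proof.
apply: eqmx_sym; apply/eqmxP; rewrite -(geq_leqif (mxrank_leqif_eq _)).
  by rewrite !rank_orthm subKn ?rank_leq_col.
apply/row_subP => i; apply/orthmP => d dO; rewrite inner_sym//.
exact: (orthmP _ _).2 dO _ (row_sub i D).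
Qed.

End Orthogonal.

(** * Orthogonal projections *)

Section Projection.
Variables (R : realType) (n : nat) (A : 'M[R]_n).
Hypothesis iA : is_inner A.

(** The subtracted term is the component along D, computed with the Gram matrix [S *m A *m S^T] of
    the frame [S]. This expression, rational in the frame and the metric, exhibits the
    differentiable dependence on the point that [proj_mx] hides. *)
Lemma proj_orthm_frame k r (D : 'M[R]_(k, n)) (S : 'M[R]_(r, n)) (x : 'rV[R]_n) :
  row_free S -> (D == S)%MS ->
  x *m proj_mx (orthm A D) (orthm A (orthm A D)) =
  x - x *m A *m S^T *m invmx (S *m A *m S^T) *m S.
Proof.
move=> fS /eqmxP DS; have iK := inner_pullback iA fS.
set b := _ *m S; have bD : (b <= orthm A (orthm A D))%MS.
  by rewrite orthmK// DS submxMl.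
have aT : (x - b <= orthm A D)%MS.
  apply/orthmP => d; rewrite DS => /submxP[c ->]; rewrite /bform trmx_mul mulmxA.
  rewrite mulmxBl mulmxBl /b -(mulmxA _ S) -(mulmxA _ (S *m A)) mulmxKV; last first.
    exact: inner_unit.
  by rewrite subrr mul0mx mxE.
rewrite -{1}(subrK b x) mulmxDl (proj_mx_id (cap_orthm iA _) aT).
by rewrite (proj_mx_0 (cap_orthm iA _) bD) addr0.
Qed.

Lemma proj_orthm_sum k (D : 'M[R]_(k, n)) (x : 'rV[R]_n) :
  x *m proj_mx (orthm A (orthm A D)) (orthm A D) +
  x *m proj_mx (orthm A D) (orthm A (orthm A D)) = x.
Proof.
by rewrite addrC; apply: add_proj_mx; [exact: cap_orthm|exact: add_orthm].
Qed.

Lemma bform_proj k (D : 'M[R]_(k, n)) (x z : 'rV[R]_n) : (z <= D)%MS ->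
  bform A (x *m proj_mx (orthm A (orthm A D)) (orthm A D)) z = bform A x z.
Proof.
move=> zD; rewrite -[in RHS](proj_orthm_sum D x) bformDl.
rewrite [X in _ = _ + X]((orthmP _ _ _).2 _ _ zD) ?addr0//.
exact: proj_mx_sub.
Qed.

End Projection.

(** * Bundle-like metrics and the Levi-Civita connection *)

Section BundleLike.
Variables (R : realType) (n r : nat) (M : manifold R n) (g : bilfield M).
Variable D : plane_field M.
Hypothesis ig : forall p, is_inner (g p).
Hypothesis dg : forall p, pdmx p (bil_comp p g).
Hypothesis sD : smooth_plane_field r D.

Definition leaf_part (X : vfield M) : vfield M :=
  apply_end (fun q => proj_mx (orth g D q) (orth g (orth g D) q)) X.

Lemma pdmx_leaf_part X p : vfield_on setT X -> pdmx p (vec_comp p (leaf_part X)).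
Proof.
move=> sX; have [U [oU Up [E [sE hE]]]] := sD p.
pose S q : 'M[R]_(r, n) := \matrix_i E i q.
pose Sc q : 'M[R]_(r, n) := \matrix_i vec_comp p (E i) q.
have ScE q : Sc q = S q *m trans (chart_at q) (chart_at p) q.
  by apply/row_matrixP => i; rewrite rowK row_mul rowK.
have dSc : pdmx p Sc.
  move=> i j; apply: near_eq_pd (vfield_on_pdmx (sE i) Up 0 j).
  by near=> q; rewrite [RHS]mxE.
have dX := vfield_on_pdmx sX (I : setT p).
have bilE q k l (Y : 'M[R]_(k, n)) (Z : 'M[R]_(l, n)) : dom (chart_at p) q ->
    Y *m trans (chart_at q) (chart_at p) q *m bil_comp p g q
      *m (Z *m trans (chart_at q) (chart_at p) q)^T = Y *m g q *m Z^T.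
  move=> aq; have cq := chart_atP q; rewrite /bil_comp /bil_in trmx_mul !mulmxA.
  rewrite -(mulmxA Y (trans _ _ _)) transV// mulmx1.
  by rewrite -(mulmxA (Y *m g q)) -trmx_mul transV// trmx1 mulmx1.
have near_U : \forall q \near p, dom (chart_at p) q /\ U q.
  apply: filterI; first exact/near_dom/chart_atP.
  exact: open_nbhs_nbhs.
pose K q := Sc q *m bil_comp p g q *m (Sc q)^T.
have dK : pdmx p K by apply: pdmxM; [exact: pdmxM|exact: pdmxT].
have uK : \forall q \near p, K q \in unitmx.
  apply: filterS near_U => q [aq Uq]; rewrite /K ScE bilE//.
  have [fS _] := hE _ Uq; exact: inner_unit (inner_pullback (ig q) fS).
(* The frame formula of [proj_orthm_frame] with every ingredient written in the chart of [p]; the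
   changes of chart cancel inside the inner products by [bilE]. *)
pose Ac q := vec_comp p X q -
  vec_comp p X q *m bil_comp p g q *m (Sc q)^T *m invmx (K q) *m Sc q.
have dA : pdmx p Ac.
  apply: pdmxD => //; apply: pdmxN; apply: pdmxM => //.
  apply: pdmxM; last exact: pdmx_invmx.
  by apply: pdmxM; [exact: pdmxM|exact: pdmxT].
apply: near_eq_pdmx dA; apply: filterS near_U => q [aq Uq].
have [fS DS] := hE _ Uq.
rewrite /vec_comp /leaf_part /apply_end (proj_orthm_frame (ig q) _ fS DS).
rewrite /vec_in mulmxBl /Ac /K !ScE /vec_comp /vec_in !bilE//.
by rewrite !mulmxA.
Unshelve. all: by end_near. Qed.

Lemma near_sym (p : M) : \forall q \near p, (g q)^T = g q.
Proof. by near=> q; case: (ig q). Unshelve. all: by end_near. Qed.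

Lemma leaf_part_orth X (z : 'rV[R]_n) p : (z <= D p)%MS ->
  bform (g p) (leaf_part X p) z = 0.
Proof. by move=> zD; apply: (orthmP _ _ _).2 zD; exact: proj_mx_sub. Qed.

Lemma cov_leaf_part X Z u p : vfield_on setT X -> Gamma D Z ->
  bform (g p) (cov g p u (leaf_part X)) (Z p) =
  - bform (g p) (leaf_part X p) (cov g p u Z).
Proof.
move=> sX [sZ DZ]; apply/eqP; rewrite -addr_eq0; apply/eqP.
rewrite -metric_compat//; first last.
- exact: vfield_on_pdmx sZ I.
- exact: pdmx_leaf_part.
- exact: near_sym.
rewrite -[RHS](dd_cst p u 0); apply: near_eq_dd; near=> q.
exact: leaf_part_orth (DZ q).
Unshelve. all: by end_near. Qed.

Lemma bundle_like_cov : bundle_like g (orth g D) <->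
  forall X Y Z, vfield_on setT X -> Gamma D Y -> Gamma D Z -> forall p,
    bform (g p) (leaf_part X p) (cov g p (Y p) Z + cov g p (Z p) Y) = 0.
Proof.
have GD Y : Gamma (orth g (orth g D)) Y <-> Gamma D Y.
  by split=> -[sY DY]; split=> // p; have := DY p; rewrite (orthmK (ig p)).
have key X Y Z p : vfield_on setT X -> Gamma D Y -> Gamma D Z ->
    (dirder X (fun q => ip g q (Y q) (Z q)) p
     = ip g p (intrinsic_connection g (orth g D) X Y p) (Z p)
       + ip g p (Y p) (intrinsic_connection g (orth g D) X Z p)) <->
    bform (g p) (leaf_part X p) (cov g p (Y p) Z + cov g p (Z p) Y) = 0.
  move=> sX hY hZ; have [[sY DY] [sZ DZ]] := (hY, hZ).
  (* Against a vector of D the outer projection drops out. Writing [QX, V] as nabla_QX V - nabla_V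
     QX, the two derivatives of V along the parts of X recombine to nabla_X V. *)
  have intE V W : (W <= D p)%MS ->
      ip g p (intrinsic_connection g (orth g D) X V p) W =
      bform (g p) (cov g p (X p) V - cov g p (V p) (leaf_part X)) W.
    move=> DW; rewrite -[LHS]/(bform (g p) _ W) /intrinsic_connection.
    rewrite (bform_proj (ig p))// nablaE (bracketE _ _ (ig p) (near_sym p)).
    by rewrite addrA -covDl /apply_end (proj_orthm_sum (ig p)).
  rewrite intE// -[X in _ = _ + X]/(bform (g p) _ _) (inner_sym (Y p) _ (ig p)).
  rewrite -[X in _ = _ + X]/(ip g p _ _) intE//.
  have -> : dirder X (fun q => ip g q (Y q) (Z q)) p =
      bform (g p) (cov g p (X p) Y) (Z p) + bform (g p) (cov g p (X p) Z) (Y p).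
    rewrite (inner_sym _ (Y p) (ig p)) -metric_compat//.
    - exact: near_sym.
    - exact: vfield_on_pdmx sY I.
    - exact: vfield_on_pdmx sZ I.
  rewrite !bformDl !bformNl !cov_leaf_part// bformDr; split; lra.
split=> h X Y Z sX hY hZ p.
  by apply/key => //; apply: h => //; exact/GD.
by apply/key; [|exact/GD|exact/GD|apply: h => //; exact/GD].
Qed.

End BundleLike.

(** * Second fundamental form of a CR-submanifold *)

Section CRSubmanifold.
Variables (R : realType) (m n r : nat) (N : manifold R m) (J : endfield N).
Variables (gN : bilfield N) (omega : covfield N) (B : vfield N).
Variables (M : manifold R n) (F : M -> N) (D : plane_field M).
Hypotheses (hJ : almost_hermitian_on setT J gN) (homega : lee_form J gN omega).
Hypotheses (hB : lee_field gN omega B) (hCR : CR_submanifold J gN F r D).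

Let g := induced_metric F gN.
Let sF : smooth_map F. Proof. by case: hCR => -[]. Qed.
Let fL p : row_free (dmap F p). Proof. by case: hCR => -[]. Qed.
Let iN y : is_inner (gN y).
Proof. by case: hJ => mg _ _ _; exact: metric_on_inner. Qed.
Let dN y : pdmx y (bil_comp y gN).
Proof. by case: hJ => mg _ _ _; exact: metric_on_pdmx. Qed.
Let ig p : is_inner (g p). Proof. exact: inner_pullback. Qed.

Let normalJ p (x y : 'rV[R]_n) : (x <= orth g D p)%MS ->
  bform (gN (F p)) (y *m dmap F p) (x *m dmap F p *m J (F p)) = 0.
Proof.
case: hCR => _ _ _ hT xT; rewrite (inner_sym _ _ (iN _)).
apply: (orthmP (gN (F p)) (dmap F p) _).2 (submxMl _ _).
by apply: submx_trans (hT p); rewrite !submxMr.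
Qed.

Let J_isom y (v w : 'rV[R]_m) :
  bform (gN y) (v *m J y) (w *m J y) = bform (gN y) v w.
Proof. by case: hJ => _ _ _; apply. Qed.

(** Invariance of D under J places J V in the image of [dmap F], where [pinvmx] does give a
    preimage. *)
Lemma push_tangentJ V : (forall q, (V q <= D q)%MS) ->
  push F (tangentJ J F V) = fun q => push F V q *m J (F q).
Proof.
move=> DV; apply/funext => q; rewrite /push /tangentJ mulmxKpV//.
case: hCR => _ _ /(_ q)/andP[hD _] _.
apply: submx_trans (submxMl (D q) (dmap F q)); apply: submx_trans hD.
by rewrite /push !submxMr.
Qed.

(** The Leibniz rule nabla_u(JW) = J nabla_u W + (nabla_u J) W; by the chain rule J is
    differentiated in the direction dF(u). *)
Lemma cov_along_J p u W : pdmx p (along_comp F p W) ->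
  cov_along F gN p u (fun q => W q *m J (F q)) =
  cov_along F gN p u W *m J (F p) + tensorJ J gN (F p) (u *m dmap F p) (W p).
Proof.
move=> dW; have dJ := almost_hermitian_pdmx (F p) hJ.
have W0 : along_comp F p W p = W p.
  by rewrite /along_comp /vec_in trans_id ?mulmx1//; exact: chart_atP.
rewrite /cov_along (near_eq_dmx _ (near_along_end sF p J W)).
rewrite dmxM//; last exact: pdmx_comp.
rewrite dmx_comp// /= end_comp_at W0 /tensorJ mulmxDl.
by rewrite -!addrA; congr (_ + _); rewrite [RHS]addrC -!addrA addNr addr0.
Qed.

(** J x is normal, so only the ambient derivative of JV counts, and J being an isometry turns g(J
    nabla_U V, J x) into g(nabla_U V, x). In (nabla_U J) V the multiple of U drops because J x is
    normal, and the multiple of JU because U is orthogonal to x. Exchanging U and V and adding, the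
    Omega terms cancel and the two halves of g(U, V) JB cancel g(U, V) A. *)
Lemma second_fundamental_form_J U V p (x : 'rV[R]_n) :
  Gamma D U -> Gamma D V -> (x <= orth g D p)%MS ->
  bform (gN (F p))
    (ip g p (U p) (V p) *: anti_lee J B (F p)
     + second_fundamental_form F gN U (tangentJ J F V) p
     + second_fundamental_form F gN V (tangentJ J F U) p)
    (x *m dmap F p *m J (F p)) =
  bform (g p) x (cov g p (U p) V + cov g p (V p) U).
Proof.
move=> hU hV xT.
have [S [f [SFp hf hom]]] := homega (F p).
have hb v : bform (gN (F p)) v (B (F p)) = dd (F p) v f.
  rewrite [LHS](hB (F p) v) hom// mxE; apply: eq_bigr => i _.
  by rewrite !mxE.
have hh X Y : Gamma D X -> Gamma D Y ->
    bform (gN (F p)) (second_fundamental_form F gN X (tangentJ J F Y) p)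
      (x *m dmap F p *m J (F p)) =
    bform (g p) x (cov g p (X p) Y) + 2^-1 *
     (ip g p (X p) (Y p) * bform (gN (F p)) (B (F p) *m J (F p))
                                   (x *m dmap F p *m J (F p))
      - bform (gN (F p)) (X p *m dmap F p) (Y p *m dmap F p *m J (F p))
        * bform (gN (F p)) (B (F p)) (x *m dmap F p *m J (F p))).
  move=> [sX DX] [sY DY]; rewrite /second_fundamental_form push_tangentJ//.
  rewrite nabla_alongE bformDl bformNl /push normalJ// subr0.
  rewrite cov_along_J; last by apply: pdmx_push => //; exact: vfield_on_pdmx sY I.
  rewrite bformDl J_isom gauss_formula//; last exact: vfield_on_pdmx sY I.
  rewrite (inner_sym _ _ (ig p)); congr (_ + _).
  rewrite (lck_tensorJ _ _ hJ hf SFp hb) bformZl; congr (_ * _).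
  rewrite !(bformDl, bformNl, bformZl) normalJ// J_isom.
  have -> : bform (gN (F p)) (X p *m dmap F p) (x *m dmap F p) = 0.
    rewrite -bform_mulmx (inner_sym _ _ (ig p)).
    exact: (orthmP _ _ _).2 xT _ (DX p).
  have -> : ip g p (X p) (Y p) =
      bform (gN (F p)) (X p *m dmap F p) (Y p *m dmap F p) by exact: bform_mulmx.
  rewrite /push; ring.
rewrite bformDl [bform _ (_ *: _ + _) _]bformDl (hh U V)//.
rewrite (hh V U)// bformDr bformZl /anti_lee bformNl.
have -> : ip g p (V p) (U p) = ip g p (U p) (V p) by exact: inner_sym.
(* Antisymmetry of Omega: g(V, JU) = g(JV, JJU) = -g(JV, U). *)
have -> : bform (gN (F p)) (V p *m dmap F p) (U p *m dmap F p *m J (F p)) =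
    - bform (gN (F p)) (U p *m dmap F p) (V p *m dmap F p *m J (F p)).
  rewrite -[LHS]J_isom -(mulmxA (U p *m dmap F p)); case: hJ => _ _ -> // _.
  by rewrite mulmxN mulmx1 bformNr (inner_sym _ _ (iN _)).
lra.
Qed.

(** Tangent vectors are always orthogonal to J x, so the condition only tests the normal component
    of [w], and within the normal space it defines [mu]. *)
Lemma sub_tangent_mu p (w : 'rV[R]_m) :
  (w <= dmap F p + mu J gN F D p)%MS <->
  forall x : 'rV[R]_n, (x <= orth g D p)%MS ->
    bform (gN (F p)) w (x *m dmap F p *m J (F p)) = 0.
Proof.
have muE (v : 'rV[R]_m) : (v <= mu J gN F D p)%MS =
    (v <= orthm (gN (F p)) (dmap F p))%MS &&
    (v <= orthm (gN (F p)) (orth g D p *m dmap F p *m J (F p)))%MS.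
  exact: sub_capmx.
split=> [/sub_addsmxP[[c1 c2] /= ->] x xT|h].
  rewrite bformDl normalJ// add0r.
  have : (c2 *m mu J gN F D p <= mu J gN F D p)%MS by exact: submxMl.
  rewrite muE => /andP[_ /orthmP]; apply.
  by rewrite !submxMr.
have /sub_addsmxP[[c1 c2] /= E] := add_orthm (iN (F p)) (dmap F p) w.
rewrite E addmx_sub_adds ?submxMl// muE submxMl /=.
apply/orthmP => _ /submxP[c ->].
rewrite (mulmxA c) (mulmxA c).
have cT : (c *m orth g D p <= orth g D p)%MS by exact: submxMl.
by have := h _ cT; rewrite E bformDl normalJ// add0r.
Qed.

End CRSubmanifold.

Theorem theorem4p1 (R : realType) (m n r : nat)
    (N : manifold R m) (J : endfield N) (gN : bilfield N)
    (omega : covfield N) (B : vfield N)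
    (M : manifold R n) (F : M -> N) (D : plane_field M)
    (hlck : lck J gN) (homega : lee_form J gN omega)
    (hB : lee_field gN omega B)
    (hCR : CR_submanifold J gN F r D) :
  let g := induced_metric F gN in
  let A := anti_lee J B in
  let h := second_fundamental_form F gN in
  bundle_like g (orth g D) <->
  (forall U V : vfield M, Gamma D U -> Gamma D V -> forall p : M,
     let W : 'rV[R]_m := ip g p (U p) (V p) *: A (F p)
       + h U (tangentJ J F V) p + h V (tangentJ J F U) p in
     (W <= dmap F p + mu J gN F D p)%MS).
Proof.
move=> g A h; have [hJ _] := hlck; have [[sF fL] sD _ _] := hCR.
have [mg _ _ _] := hJ.
have iN y : is_inner (gN y) by exact: metric_on_inner.
have dN y : pdmx y (bil_comp y gN) by exact: metric_on_pdmx.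
have ig p : is_inner (g p) by exact: inner_pullback.
have dg p : pdmx p (bil_comp p g) by exact: pdmx_induced.
apply: (iff_trans (bundle_like_cov ig dg sD)); split=> H.
  move=> U V hU hV p /=; apply/(sub_tangent_mu hJ hCR) => x xT.
  rewrite (second_fundamental_form_J hJ homega hB hCR)//.
  have [X sX Xp] := vfield_extension p x.
  rewrite -(H X U V sX hU hV p) /leaf_part /apply_end Xp.
  (* At [p] the projection fixes the value [x] of the extension, since [x] is already totally
     real. *)
  by rewrite (proj_mx_id (cap_orthm (ig p) _) xT).
move=> X Y Z sX hY hZ p.
have xT : (leaf_part g D X p <= orth g D p)%MS by exact: proj_mx_sub.
rewrite -(second_fundamental_form_J hJ homega hB hCR hY hZ xT).
exact: (sub_tangent_mu hJ hCR p _).1 (H Y Z hY hZ p) _ xT.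
Qed.
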